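(* Let $G$ be a spatial partition quantum group (defined by any rigid category of spatial partitions, i.e. with any pair of duality partitions satisfying the conjugate equations). Then there exist $m\ge 1$, $\boldsymbol n\in\mathbb N^m$ and an $\boldsymbol n$-graded rigid category of spatial partitions $\mathcal C\subseteq\mathcal P^{(m)}$ containing the duality partitions $(\mathrm{id}_{S_m})_{\circ\bullet}$ and $(\mathrm{id}_{S_m})_{\bullet\circ}$ such that $G$ is equivalent to $G_{\boldsymbol n}(\mathcal C)$.
   Context: Colours: $\{\circ,\bullet\}^*$ is the free monoid of finite words in two colours with empty word $1$; $|x|$ is the length and $x_i$ the $i$-th letter of $x$. Spatial partitions: for $m\ge1$, $\mathcal P^{(m)}(x,y)$ is the set of set partitions (into blocks) of $\{1,\dots,|x|+|y|\}\times\{1,\dots,m\}$; points $(i,j)$ with $i\le|x|$ are upper points of colour $x_i$, points $(|x|+i,j)$ are lower points of colour $y_i$, and $j$ is the level. $\mathcal P^{(m)}=\bigcup_{x,y}\mathcal P^{(m)}(x,y)$. Tensor product $p\otimes q\in\mathcal P^{(m)}(xw,yz)$ of $p\in\mathcal P^{(m)}(x,y)$, $q\in\mathcal P^{(m)}(w,z)$: place $q$ to the right of $p$. Involution $p^*\in\mathcal P^{(m)}(y,x)$: swap upper and lower points. Composition $pq\in\mathcal P^{(m)}(x,z)$ of $p\in\mathcal P^{(m)}(y,z)$, $q\in\mathcal P^{(m)}(x,y)$: identify each lower point of $q$ with the corresponding upper point of $p$, merge blocks sharing identified points, delete the identified points and any resulting empty blocks. $\mathrm{id}_x\in\mathcal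 P^{(m)}(x,x)$ has blocks $\{(i,j),(|x|+i,j)\}$. For $\sigma\in S_m$ and colours $a,b$, $\sigma_{ab}\in\mathcal P^{(m)}(1,ab)$ has blocks $\{(1,i),(2,\sigma(i))\}$, $1\le i\le m$. A category of spatial partitions on $m$ levels is a subset $\mathcal C\subseteq\mathcal P^{(m)}$ closed under composition, tensor product and involution and containing $\mathrm{id}_\circ,\mathrm{id}_\bullet$; $\mathcal C(x,y)=\mathcal C\cap\mathcal P^{(m)}(x,y)$. It is rigid if there are (duality partitions) $r\in\mathcal C(1,\circ\bullet)$, $s\in\mathcal C(1,\bullet\circ)$ with $(r^*\otimes\mathrm{id}_\circ)(\mathrm{id}_\circ\otimes s)=\mathrm{id}_\circ$ and $(s^*\otimes\mathrm{id}_\bullet)(\mathrm{id}_\bullet\otimes r)=\mathrm{id}_\bullet$ (the conjugate equations). For $\boldsymbol n=(n_1,\dots,n_m)\in\mathbb N^m$, $p$ is $\boldsymbol n$-graded if $n_k=n_\ell$ whenever points $(i,k),(j,\ell)$ lie in one block; $\mathcal C$ is $\boldsymbol n$-graded if all its elements are. (Cébron–Weber's categories are those containing $(\mathrm{id}_{S_m})_{\circ\bullet}$ and $(\mathrm{id}_{S_m})_{\bullet\circ}$.) Quantum groups: for a finite-dimensional Hilbert space $V$ with conjugate $\overline V$, put $V^\circ=V$, $V^\bullet=\overline V$, $V^{\otimes x}=V^{x_1}\otimes\cdots\otimes V^{x_{|x|}}$ ($\mathbb C$ if $x=1$); for an operator $T$, $\overline T(\overline v)=\overline{T(v)}$, $T^\circ=T$,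 $T^\bullet=\overline T$, $T^{\otimes x}=T^{x_1}\otimes\cdots\otimes T^{x_{|x|}}$. Elements $u\in B(V)\otimes A$ ($A$ a unital $C^*$-algebra) are $A$-valued matrices $(u^i_j)$ in an orthonormal basis; $\overline u\in B(\overline V)\otimes A$ has entries $(u^i_j)^*$; $u\top v$ on $V\otimes W$ has entries $u^{i_1}_{j_1}v^{i_2}_{j_2}$. A compact matrix quantum group is $G=(C(G),u)$ with $C(G)$ a unital $C^*$-algebra generated by the entries of $u\in B(V)\otimes C(G)$, $u$ unitary, $\overline u$ invertible, and a $*$-homomorphism $\Delta:C(G)\to C(G)\otimes C(G)$ with $\Delta(u^i_j)=\sum_k u^i_k\otimes u^k_j$; $\mathcal O(G)$ is the $*$-algebra generated by the entries. A representation is an invertible $v\in B(W)\otimes C(G)$ with $\Delta(v^i_j)=\sum_k v^i_k\otimes v^k_j$; $\mathrm{Hom}(v,w)=\{T: Tv=wT\}$. Given $u^\circ=u$ and a unitary representation $u^\bullet$ on $\overline V$, $u^x=u^{x_1}\top\cdots\top u^{x_{|x|}}$, $u^1=1$. $u^\bullet$ is conjugate to $u^\circ$ if there are $R\in\mathrm{Hom}(1,u^\circ\top u^\bullet)$, $S\in\mathrm{Hom}(1,u^\bullet\top u^\circ)$ with $(R^*\otimes\mathrm{id}_V)(\mathrm{id}_V\otimes S)=\mathrm{id}_V$, $(S^*\otimes\mathrm{id}_{\overline V})(\mathrm{id}_{\overline V}\otimes R)=\mathrm{id}_{\overline V}$. Linear maps: $[\boldsymbol n]=\prod_k\{1,\dots,n_k\}$,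 $\mathbb C^{\boldsymbol n}=\mathbb C^{n_1}\otimes\cdots\otimes\mathbb C^{n_m}$ with basis $e_{\boldsymbol i}$, $\boldsymbol i\in[\boldsymbol n]$. For $\boldsymbol n$-graded $p\in\mathcal P^{(m)}(x,y)$, $T_p^{(\boldsymbol n)}:(\mathbb C^{\boldsymbol n})^{\otimes x}\to(\mathbb C^{\boldsymbol n})^{\otimes y}$ has, in the canonical bases, matrix coefficient (input $\boldsymbol j_1,\dots,\boldsymbol j_{|x|}$, output $\boldsymbol i_1,\dots,\boldsymbol i_{|y|}$) equal to $1$ if, labelling upper point $(k,\ell)$ by the $\ell$-th entry of $\boldsymbol j_k$ and lower point $(|x|+k,\ell)$ by the $\ell$-th entry of $\boldsymbol i_k$, labels are constant on every block, and $0$ otherwise. For an $\boldsymbol n$-graded rigid category $\mathcal C\subseteq \mathcal P^{(m)}$, $G_{\boldsymbol n}(\mathcal C)$ is the compact matrix quantum group with fundamental representation $u^\circ$ on $\mathbb C^{\boldsymbol n}$ and a unitary representation $u^\bullet$ on $\overline{\mathbb C^{\boldsymbol n}}$ such that $\mathrm{Hom}(u^x,u^y)=\mathrm{span}\{T_p^{(\boldsymbol n)}:p\in\mathcal C(x,y)\}$ for all $x,y$ (it exists by Woronowicz Tannaka–Krein duality, $\mathcal O(G)$ is unique, and $C(G)$ is taken to be the universal $C^*$-completion). A compact matrix quantum group $G$ with fundamental representation $u^\circ$ on $V$ is a spatial partition quantum group if there are a unitary representation $u^\bullet$ on $\overline V$, an $\boldsymbol n$-graded rigid category $\mathcal C\subseteq\mathcal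 P^{(m)}$ (some $m$, $\boldsymbol n\in \mathbb N^m$) and a unitary $Q:\mathbb C^{\boldsymbol n}\to V$ with $\mathrm{Hom}(u^x,u^y)=\mathrm{span}\{Q^{\otimes y}T_p^{(\boldsymbol n)}(Q^{-1})^{\otimes x}:p\in\mathcal C(x,y)\}$ for all $x,y$. Equivalence: compact matrix quantum groups $G$, $H$ with fundamental representations $u^\circ$ on $V$, $w^\circ$ on $W$ are equivalent if, for some unitary conjugate representations $u^\bullet$ on $\overline V$ and $w^\bullet$ on $\overline W$, there is a unitary $Q:V\to W$ with $\mathrm{Hom}(u^x,u^y)=(Q^{-1})^{\otimes y}\,\mathrm{Hom}(w^x,w^y)\,Q^{\otimes x}$ for all $x,y\in\{\circ,\bullet\}^*$. *)

(* Defs.v *)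
From HB Require Import structures.
From mathcomp Require Import all_boot all_order all_algebra all_fingroup.
From mathcomp Require Import all_classical all_reals all_analysis.
From mathcomp Require Import complex.

Set Implicit Arguments.
Unset Strict Implicit.
Unset Printing Implicit Defensive.

Import Order.TTheory GRing.Theory Num.Theory.
Import numFieldNormedType.Exports.

Local Open Scope ring_scope.
Local Open Scope complex_scope.

Inductive colour := White | Black.
Notation word := (seq colour).

Definition letter (x : word) (k : 'I_(size x)) : colour := tnth (in_tuple x) k.
Arguments letter : clear implicits.

Definition lpos (x w : word) (i : 'I_(size x)) : 'I_(size (x ++ w)) :=
  cast_ord (esym (size_cat x w)) (lshift (size w) i).
Definition rpos (x w : word) (i : 'I_(size w)) : 'I_(size (x ++ w)) :=
  cast_ord (esym (size_cat x w)) (rshift (size x) i).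

(* (inl i, l) is the i-th upper point and (inr i, l) the i-th lower point on
   level l; positions and levels are numbered from 0. *)
Definition spoint (m : nat) (x y : word) : finType :=
  (('I_(size x) + 'I_(size y)) * 'I_m)%type.

(* A set of blocks; that it is a partition of all the points is required in
   [spatial_category]. *)
Definition spart (m : nat) (x y : word) : finType := {set {set spoint m x y}}.

Section Partitions.
Variable m : nat.

Definition lpoint x y w z (u : spoint m x y) : spoint m (x ++ w) (y ++ z) :=
  (match u.1 with inl i => inl (lpos w i) | inr j => inr (lpos z j) end, u.2).
Definition rpoint x y w z (u : spoint m w z) : spoint m (x ++ w) (y ++ z) :=
  (match u.1 with inl i => inl (rpos x i) | inr j => inr (rpos y j) end, u.2).

Definition sp_tensor x y w z (p : spart m x y) (q : spart m w z) :
    spart m (x ++ w) (y ++ z) :=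
  [set (@lpoint x y w z) @: (B : {set spoint m x y}) | B in p]
    :|: [set (@rpoint x y w z) @: (B : {set spoint m w z}) | B in q].

Definition flip_point x y (u : spoint m x y) : spoint m y x :=
  (match u.1 with inl i => inr i | inr j => inl j end, u.2).

Definition sp_inv x y (p : spart m x y) : spart m y x :=
  [set (@flip_point x y) @: (B : {set spoint m x y}) | B in p].

Definition sp_id x : spart m x x :=
  [set [set (inl u.1, u.2); (inr u.1, u.2)] | u : 'I_(size x) * 'I_m].

(* The composition p q lives on three rows of points (upper row x, middle row
   y shared by q and p, lower row z). *)
Definition row3 (x y z : word) : finType :=
  (('I_(size x) + 'I_(size y) + 'I_(size z)) * 'I_m)%type.
Definition top_rows x y z (u : spoint m x y) : row3 x y z := (inl u.1, u.2).
Definition bot_rows x y z (u : spoint m y z) : row3 x y z :=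
  (match u.1 with inl j => inl (inr j) | inr k => inr k end, u.2).
Definition out_rows x y z (u : spoint m x z) : row3 x y z :=
  (match u.1 with inl i => inl (inl i) | inr k => inr k end, u.2).

Definition same_block x y z (p : spart m y z) (q : spart m x y) :
    rel (row3 x y z) := fun u v =>
  [exists B in q, (u \in @top_rows x y z @: B) && (v \in @top_rows x y z @: B)]
  || [exists B in p, (u \in @bot_rows x y z @: B) && (v \in @bot_rows x y z @: B)].

Definition sp_comp x y z (p : spart m y z) (q : spart m x y) : spart m x z :=
  equivalence_partition
    (fun u v : spoint m x z =>
       connect (same_block p q) (out_rows y u) (out_rows y v))
    [set: spoint m x z].

Definition sp_perm (sigma : 'S_m) (a b : colour) : spart m [::] [:: a; b] :=
  [set [set (inr (ord0 : 'I_2), i); (inr (ord_max : 'I_2), sigma i)]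
     | i : 'I_m].

Definition graded_part (n : 'I_m -> nat) x y (p : spart m x y) : Prop :=
  forall (B : {set spoint m x y}) (u v : spoint m x y),
    B \in p -> u \in B -> v \in B -> n u.2 = n v.2.

Definition spart_family := forall x y : word, {set spart m x y}.

Record spatial_category (C : spart_family) : Prop := {
  cat_partition : forall x y p, p \in C x y -> finset.partition p [set: spoint m x y];
  cat_id_white : sp_id [:: White] \in C [:: White] [:: White];
  cat_id_black : sp_id [:: Black] \in C [:: Black] [:: Black];
  cat_comp : forall x y z (p : spart m y z) (q : spart m x y),
    p \in C y z -> q \in C x y -> sp_comp p q \in C x z;
  cat_tensor : forall x y w z (p : spart m x y) (q : spart m w z),
    p \in C x y -> q \in C w z -> sp_tensor p q \in C (x ++ w) (y ++ z);
  cat_inv : forall x y (p : spart m x y), p \in C x y -> sp_inv p \in C y x }.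

(* The middle words of the two compositions agree by computation, e.g.
   [White; Black] ++ [White] and [White] ++ [Black; White]. *)
Definition rigid (C : spart_family) : Prop :=
  exists (r : spart m [::] [:: White; Black])
         (s : spart m [::] [:: Black; White]),
  [/\ r \in C [::] [:: White; Black],
      s \in C [::] [:: Black; White],
      @sp_comp [:: White] [:: White; Black; White] [:: White]
        (sp_tensor (sp_inv r) (sp_id [:: White])) (sp_tensor (sp_id [:: White]) s)
        = sp_id [:: White] &
      @sp_comp [:: Black] [:: Black; White; Black] [:: Black]
        (sp_tensor (sp_inv s) (sp_id [:: Black])) (sp_tensor (sp_id [:: Black]) r)
        = sp_id [:: Black]].

Definition graded (n : 'I_m -> nat) (C : spart_family) : Prop :=
  forall x y p, p \in C x y -> graded_part n p.

End Partitions.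

(* The norm is a field of the structure: it is real-valued, whereas the norm of
   a normedModType R[i] takes its values in R[i], and HB admits no structure
   below both GRing.Algebra and NormedModule. *)
HB.mixin Record isCStarAlgebra (R : realType) A of GRing.Algebra R[i] A := {
  star : A -> A;
  cnorm : A -> R;
  starK : involutive star;
  starD : {morph star : a b / a + b};
  starZ : forall (c : R[i]) (a : A), star (c *: a) = c^* *: star a;
  starM : forall a b : A, star (a * b) = star b * star a;
  cnorm_eq0 : forall a : A, cnorm a = 0 -> a = 0;
  cnormD_le : forall a b : A, cnorm (a + b) <= cnorm a + cnorm b;
  cnormZ : forall (c : R[i]) (a : A), (cnorm (c *: a))%:C = `|c| * (cnorm a)%:C;
  cnormM_le : forall a b : A, cnorm (a * b) <= cnorm a * cnorm b;
  cnorm_star : forall a : A, cnorm (star a * a) = cnorm a ^+ 2;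
  cnorm_complete : forall a : nat -> A,
    (forall e : R, 0 < e -> exists N : nat, forall p q : nat,
       (N <= p)%N -> (N <= q)%N -> cnorm (a p - a q) < e) ->
    exists l : A, forall e : R, 0 < e -> exists N : nat, forall p : nat,
       (N <= p)%N -> cnorm (a p - l) < e }.

#[short(type="cstarAlgType")]
HB.structure Definition CStarAlgebra (R : realType) :=
  { A of GRing.Algebra R[i] A & isCStarAlgebra R A }.

Definition norm_dense (R : realType) (A : cstarAlgType R) (B : set A) : Prop :=
  forall (a : A) (e : R), 0 < e -> exists2 b, B b & cnorm (a - b) < e.

Section MinimalTensor.
Variable R : realType.
Implicit Types A B : cstarAlgType R.

Definition is_state A (phi : {scalar A}) : Prop :=
  (forall a : A, 0 <= phi (star a * a)) /\ phi 1 = 1.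

(* A list of pairs (a, b) stands for the element \sum a \otimes b of the
   algebraic tensor product of A and B. *)
Definition tmul A B (r s : seq (A * B)) : seq (A * B) :=
  [seq (p.1 * q.1, p.2 * q.2) | p <- r, q <- s].
Definition tstar A B (r : seq (A * B)) : seq (A * B) :=
  [seq (star p.1, star p.2) | p <- r].
Definition product_functional A B (phi : {scalar A}) (psi : {scalar B})
  (r : seq (A * B)) : R[i] := \sum_(p <- r) phi p.1 * psi p.2.

(* D, with a \otimes b represented by i1 a * i2 b, is the minimal (spatial)
   C*-tensor product of A and B.  [mt_norm] says that the norm of r is the
   supremum of the norms of (pi_phi \otimes pi_psi)(r), where pi_phi, pi_psi
   are the GNS representations of states phi of A and psi of B, written out
   on the dense subspace of vectors (pi_phi \otimes pi_psi)(s)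
   (xi_phi \otimes xi_psi). *)
Record is_min_tensor A B (D : cstarAlgType R)
    (i1 : {lrmorphism A -> D}) (i2 : {lrmorphism B -> D}) : Prop := {
  mt_star_l : {morph i1 : a / star a};
  mt_star_r : {morph i2 : b / star b};
  mt_comm : forall a b, i1 a * i2 b = i2 b * i1 a;
  mt_dense : norm_dense [set d : D | exists r : seq (A * B),
                           d = \sum_(p <- r) i1 p.1 * i2 p.2]%classic;
  mt_norm : forall (r : seq (A * B)) (M : R), 0 <= M ->
    (cnorm (\sum_(p <- r) i1 p.1 * i2 p.2) <= M <->
     forall (phi : {scalar A}) (psi : {scalar B}) (s : seq (A * B)),
       is_state phi -> is_state psi ->
       product_functional phi psi (tmul (tstar (tmul r s)) (tmul r s))
         <= M%:C ^+ 2 * product_functional phi psi (tmul (tstar s) s)) }.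

End MinimalTensor.

(* [mat S J I] is the type of S-valued matrices with rows indexed by J and
   columns by I; over R[i] these are the operators from C^I to C^J. *)
Definition mat (S : Type) (J I : finType) : Type := J -> I -> S.

Section Matrices.
Variable S : pzRingType.

Definition mmul (K J I : finType) (v : mat S K J) (w : mat S J I) : mat S K I :=
  fun k i => \sum_j v k j * w j i.
Definition mone (I : finType) : mat S I I := fun i j => (i == j)%:R.

Definition is_inverse (I : finType) (v w : mat S I I) : Prop :=
  mmul v w = @mone I /\ mmul w v = @mone I.
End Matrices.
Arguments mone {S} I.

(* The canonical basis of the tensor power along the word x of a space with
   orthonormal basis indexed by I (and of its conjugate, with the conjugate
   basis). *)
Definition idx (I : finType) (x : word) : finType := {ffun 'I_(size x) -> I}.

Section Operators.
Variable R : realType.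
Local Notation C := R[i].

Definition adj (J I : finType) (T : mat C J I) : mat C I J :=
  fun i j => (T j i)^*.
Definition mconj (J I : finType) (T : mat C J I) : mat C J I :=
  fun j i => (T j i)^*.

Definition unitary_op (J I : finType) (Q : mat C J I) : Prop :=
  mmul Q (adj Q) = mone J /\ mmul (adj Q) Q = mone I.

Definition col_op (J I : finType) (T : mat C J I) (c : colour) : mat C J I :=
  match c with White => T | Black => mconj T end.

Definition op_pow (J I : finType) (T : mat C J I) (x : word) :
    mat C (idx J x) (idx I x) :=
  fun s t => \prod_(k < size x) col_op T (letter x k) (s k) (t k).

Definition lpart (I : finType) (x w : word) (s : idx I (x ++ w)) : idx I x :=
  [ffun k => s (lpos w k)].
Definition rpart (I : finType) (x w : word) (s : idx I (x ++ w)) : idx I w :=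
  [ffun k => s (rpos x k)].

Definition op_tensor (I : finType) (x y w z : word)
    (T : mat C (idx I y) (idx I x)) (T' : mat C (idx I z) (idx I w)) :
    mat C (idx I (y ++ z)) (idx I (x ++ w)) :=
  fun s t => T (lpart s) (lpart t) * T' (rpart s) (rpart t).

Definition op_id (I : finType) (x : word) : mat C (idx I x) (idx I x) :=
  mone (idx I x).

Definition multi (m : nat) (n : 'I_m -> nat) : finType :=
  {dffun forall k : 'I_m, 'I_(n k)}.

Definition label (m : nat) (n : 'I_m -> nat) (x y : word)
    (s : idx (multi n) y) (t : idx (multi n) x) (u : spoint m x y) : nat :=
  match u.1 with inl k => t k u.2 | inr k => s k u.2 end.

Definition constant_on_blocks (m : nat) (n : 'I_m -> nat) (x y : word)
    (p : spart m x y) (s : idx (multi n) y) (t : idx (multi n) x) : bool :=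
  [forall B : {set spoint m x y}, forall u : spoint m x y,
     forall v : spoint m x y,
     [&& B \in p, u \in B & v \in B] ==> (label s t u == label s t v)].

Definition Tpart (m : nat) (n : 'I_m -> nat) (x y : word) (p : spart m x y) :
    mat C (idx (multi n) y) (idx (multi n) x) :=
  fun s t => (constant_on_blocks p s t)%:R.

Definition span_of (F : finType) (J I : finType) (P : {set F})
    (T : F -> mat C J I) : set (mat C J I) :=
  [set X | exists c : F -> C, X = fun j i => \sum_(p in P) c p * T p j i]%classic.

End Operators.
Arguments op_id R I x _ _ : clear implicits.
Arguments op_pow {R J I} T x _ _.
Arguments Tpart R {m} n {x y} p _ _.

Section StarMatrices.
Variables (R : realType) (A : cstarAlgType R).

Definition star_mx (I : finType) (u : mat A I I) : mat A I I :=
  fun i j => star (u j i).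
Definition bar_mx (I : finType) (u : mat A I I) : mat A I I :=
  fun i j => star (u i j).

Definition unitary_mx (I : finType) (u : mat A I I) : Prop :=
  is_inverse u (star_mx u).

Record star_subalgebra (B : set A) : Prop := {
  ssa_one : B 1;
  ssa_lin : forall (c : R[i]) (a b : A), B a -> B b -> B (c *: a + b);
  ssa_mul : forall a b : A, B a -> B b -> B (a * b);
  ssa_star : forall a : A, B a -> B (star a) }.

Definition generated_star_algebra (E : set A) : set A :=
  smallest star_subalgebra E.

Definition entries (I : finType) (u : mat A I I) : set A :=
  [set a | exists i j, a = u i j]%classic.

End StarMatrices.

(* Quantum groups whose fundamental representation acts on the Hilbert space
   with orthonormal basis indexed by I.  The fields qg_tens, qg_inl, qg_inr
   are a model of C(G) \otimes C(G), with a \otimes b = qg_inl a * qg_inr b. *)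
Record cmqg (R : realType) (I : finType) := CMQG {
  qg_alg : cstarAlgType R;
  qg_u : mat qg_alg I I;
  qg_tens : cstarAlgType R;
  qg_inl : {lrmorphism qg_alg -> qg_tens};
  qg_inr : {lrmorphism qg_alg -> qg_tens};
  qg_tensP : is_min_tensor qg_inl qg_inr;
  qg_Delta : {lrmorphism qg_alg -> qg_tens};
  qg_Delta_star : {morph qg_Delta : a / star a};
  qg_unitary : unitary_mx qg_u;
  qg_bar_inv : exists v, is_inverse (bar_mx qg_u) v;
  qg_gen : norm_dense (generated_star_algebra (entries qg_u));
  qg_DeltaE : forall i j, qg_Delta (qg_u i j) =
    \sum_k qg_inl (qg_u i k) * qg_inr (qg_u k j) }.

Section QuantumGroups.
Variable R : realType.
Local Notation C := R[i].

Definition unitary_rep (I : finType) (G : cmqg R I) (J : finType)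
    (v : mat (qg_alg G) J J) : Prop :=
  unitary_mx v /\
  forall i j, qg_Delta G (v i j) = \sum_k qg_inl G (v i k) * qg_inr G (v k j).

Definition rep_pow (I : finType) (A : cstarAlgType R) (u ub : mat A I I)
    (x : word) : mat A (idx I x) (idx I x) :=
  fun s t => \prod_(k < size x)
    (match letter x k with White => u | Black => ub end) (s k) (t k).
Arguments rep_pow {I A} u ub x _ _.

Definition intertwiners (A : cstarAlgType R) (I J : finType)
    (v : mat A I I) (w : mat A J J) : set (mat C J I) :=
  [set T : mat C J I |
     forall j i, \sum_k T j k *: v k i = \sum_l T l i *: w j l]%classic.

(* Hom(u^x, u^y) for the fundamental representation u of G and the
   representation ub on the conjugate space. *)
Definition qg_Hom (I : finType) (G : cmqg R I) (ub : mat (qg_alg G) I I)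
    (x y : word) : set (mat C (idx I y) (idx I x)) :=
  intertwiners (rep_pow (qg_u G) ub x) (rep_pow (qg_u G) ub y).
Arguments qg_Hom {I G} ub x y _.

Definition is_conjugate (I : finType) (G : cmqg R I) (ub : mat (qg_alg G) I I)
    : Prop :=
  exists (r : mat C (idx I [:: White; Black]) (idx I [::]))
         (s : mat C (idx I [:: Black; White]) (idx I [::])),
  [/\ qg_Hom ub [::] [:: White; Black] r,
      qg_Hom ub [::] [:: Black; White] s,
      @mmul C (idx I [:: White]) (idx I [:: White; Black; White]) (idx I [:: White])
        (op_tensor (adj r) (op_id R I [:: White]))
        (op_tensor (op_id R I [:: White]) s) = op_id R I [:: White] &
      @mmul C (idx I [:: Black]) (idx I [:: Black; White; Black]) (idx I [:: Black])
        (op_tensor (adj s) (op_id R I [:: Black]))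
        (op_tensor (op_id R I [:: Black]) r) = op_id R I [:: Black]].

(* H is G_n(C).  This determines H up to the choice of the C*-completion C(H)
   of O(H); no particular completion is singled out. *)
Definition is_partition_qg (m : nat) (n : 'I_m -> nat) (C : spart_family m)
    (H : cmqg R (multi n)) : Prop :=
  exists wb : mat (qg_alg H) (multi n) (multi n), unitary_rep wb /\
  forall x y, qg_Hom wb x y = span_of (C x y) (Tpart R n).

Definition is_spatial_partition_qg (I : finType) (G : cmqg R I) : Prop :=
  exists (ub : mat (qg_alg G) I I) (m : nat) (n : 'I_m -> nat)
         (C : spart_family m) (Q : mat R[i] I (multi n)),
  [/\ unitary_rep ub, (0 < m)%N,
      [/\ spatial_category C, graded n C & rigid C], unitary_op Q &
      forall x y, qg_Hom ub x y = span_of (C x y) (fun p =>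
        mmul (op_pow Q y) (mmul (Tpart R n p) (op_pow (adj Q) x)))].

(* For unitary Q, the inverse of Q is adj Q. *)
Definition equivalent (I J : finType) (G : cmqg R I) (H : cmqg R J) : Prop :=
  exists (ub : mat (qg_alg G) I I) (wb : mat (qg_alg H) J J) (Q : mat C J I),
  [/\ unitary_rep ub /\ is_conjugate ub, unitary_rep wb /\ is_conjugate wb,
      unitary_op Q &
      forall x y, qg_Hom ub x y =
        [set mmul (op_pow (adj Q) y) (mmul T (op_pow Q x))
           | T in qg_Hom wb x y]%classic].

End QuantumGroups.

(* Main.v *)
Require Import Defs.
From mathcomp Require Import all_boot all_order all_algebra all_fingroup.
From mathcomp Require Import all_classical all_reals all_analysis.
From mathcomp Require Import complex.

(* The conjugate equations force the duality partitions to be sigma_{wb} and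
   (sigma^-1)_{bw} for one permutation sigma of the levels.  Moving the levels
   of all black points by sigma^-1 turns the given category into a category
   containing the two identity pairings, and changes the maps T_p only by a
   permutation of the tensor factors on the black legs (the dimensions n_k and
   n_sigma(k) agree because sigma_{wb} is n-graded).  This permutation is
   absorbed into the choice of the conjugate representation, which is free in
   the definition of equivalence; the quantum group G_n(C) itself is G, written
   in the basis given by Q. *)

Set Implicit Arguments.
Unset Strict Implicit.
Unset Printing Implicit Defensive.

(** * Duality partitions *)

(** In the zigzag of a conjugate equation each level has to run from the top row through [r] and
    then [s] to the bottom row. Two levels meeting on the first leg of a block of [r] would be
    merged in the composite, and a level whose block stayed on that leg would never arrive. One
    equation controls the first leg of [r] and the other the second, which leaves only pairs; the
    zigzag then makes the two permutations inverse to each other. The obstacle at the end is that an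
    equivalence uses a single unitary, acting as itself on white legs and as its conjugate on black
    ones. After relabelling, white legs are transformed by [Q] but black legs by the conjugate of
    [Q] times a permutation, a pair that need not have that form. The discrepancy is a unitary on
    the conjugate space, and conjugating the black representation by it gives another unitary
    representation of the same [G]. Since equivalence compares only intertwiner spaces, the argument
    covers every [H] with the prescribed ones. *)

Lemma letter_lpos (x w : word) (i : 'I_(size x)) :
  letter (x ++ w) (lpos w i) = letter x i.
Proof. by rewrite /letter !(tnth_nth White) /= nth_cat ltn_ord. Qed.

Lemma letter_rpos (x w : word) (i : 'I_(size w)) :
  letter (x ++ w) (rpos x i) = letter w i.
Proof.
by rewrite /letter !(tnth_nth White) /= nth_cat ltnNge leq_addr /= addKn.
Qed.

Section EquivalencePartition.
Variables (T : finType) (e : rel T).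

Lemma mem_equivalence_partition (u v : T) :
  equivalence_rel e ->
  e u v <-> exists B : {set T}, [/\ B \in equivalence_partition e [set: T],
                                    u \in B & v \in B].
Proof.
move=> eqe; split=> [euv|[_ [/imsetP [t _ ->]]]].
- exists [set t in [set: T] | e u t]; split; last 2 first.
  + by rewrite !inE; case: (eqe u u u).
  + by rewrite !inE.
  + by apply/imsetP; exists u.
- by rewrite !inE /= => tu tv; have [_ /(_ tu) <-] := eqe t u v.
Qed.

Lemma imset_equivalence_partition (e' : rel T) (h : T -> T) :
  injective h -> (forall u v, e' (h u) (h v) = e u v) ->
  [set h @: (B : {set T}) | B in equivalence_partition e [set: T]] =
  equivalence_partition e' [set: T].
Proof.
move=> hI he; have [g hK gK] := injF_bij hI.
rewrite /equivalence_partition -imset_comp; apply/setP => B.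
apply/imsetP/imsetP => -[t _ ->] /=.
- exists (h t) => //; apply/setP => v; rewrite -(gK v) mem_imset // !inE /=.
  by rewrite he.
- exists (g t) => //; apply/setP => v; rewrite -(gK v) mem_imset // !inE /=.
  by rewrite -he !gK.
Qed.

End EquivalencePartition.

Lemma connect_homo (T T' : finType) (e : rel T) (e' : rel T') (h : T -> T') :
  (forall u v, e u v -> e' (h u) (h v)) ->
  forall u v, connect e u v -> connect e' (h u) (h v).
Proof.
move=> he u v /connectP [s es ->] {v}.
elim: s u es => [|t s IHs] u //= /andP [ut /IHs]; apply: connect_trans.
exact/connect1/he.
Qed.

Lemma connect_bij (T T' : finType) (e : rel T) (e' : rel T') (h : T -> T') :
  bijective h -> (forall u v, e' (h u) (h v) = e u v) ->
  forall u v, connect e' (h u) (h v) = connect e u v.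
Proof.
move=> [g hK gK] he u v; apply/idP/idP; last first.
  by apply: connect_homo => {}u {}v; rewrite he.
rewrite -{2}(hK u) -{2}(hK v); apply: connect_homo => s t.
by rewrite -he !gK.
Qed.

Lemma partition_inj (T : finType) (P : {set {set T}}) (D B B' : {set T}) u :
  finset.partition P D -> B \in P -> B' \in P -> u \in B -> u \in B' -> B = B'.
Proof.
move=> /and3P [_ tP _] BP B'P uB uB'.
by rewrite -(def_pblock tP BP uB) (def_pblock tP B'P uB').
Qed.

Section Composition.
Variable m : nat.

Lemma same_block_sym x y z (p : spart m y z) (q : spart m x y) :
  symmetric (same_block p q).
Proof.
move=> u v; congr (_ || _);
  by apply: eq_existsb => B; congr (_ && _); rewrite andbC.
Qed.

Lemma connect_equivalence x y z (p : spart m y z) (q : spart m x y) :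
  equivalence_rel (fun u v : spoint m x z =>
    connect (same_block p q) (out_rows y u) (out_rows y v)).
Proof.
move=> u v w; split=> [|uv]; first exact: connect0.
exact/same_connect/uv/sym_connect_sym/same_block_sym.
Qed.

Lemma same_block_top x y z (p : spart m y z) (q : spart m x y)
    (B : {set spoint m x y}) u v :
  B \in q -> u \in B -> v \in B ->
  same_block p q (top_rows z u) (top_rows z v).
Proof.
move=> Bq uB vB; apply/orP; left; apply/exists_inP; exists B => //.
by rewrite !imset_f.
Qed.

Lemma same_block_bot x y z (p : spart m y z) (q : spart m x y)
    (B : {set spoint m y z}) u v :
  B \in p -> u \in B -> v \in B ->
  same_block p q (bot_rows x u) (bot_rows x v).
Proof.
move=> Bp uB vB; apply/orP; right; apply/exists_inP; exists B => //.
by rewrite !imset_f.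
Qed.

(** An invariant of connected components: this is how [duality_meet] proves that two points are not
    joined. *)
Lemma connect_const (T : Type) x y z (p : spart m y z) (q : spart m x y)
    (f : row3 m x y z -> T) :
  (forall B u v, B \in q -> u \in B -> v \in B ->
     f (top_rows z u) = f (top_rows z v)) ->
  (forall B u v, B \in p -> u \in B -> v \in B ->
     f (bot_rows x u) = f (bot_rows x v)) ->
  forall u v, connect (same_block p q) u v -> f u = f v.
Proof.
move=> fq fp u v /connectP [s es ->] {v}.
elim: s u es => [|t s IHs] u //= /andP [ut /IHs <-].
case/orP: ut => /exists_inP [B BP /andP [/imsetP [a aB ->] /imsetP [b bB ->]]].
- exact: fq BP aB bB.
- exact: fp BP aB bB.
Qed.

Lemma sp_tensor_l x y w z (p : spart m x y) (q : spart m w z)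
    (B : {set spoint m x y}) :
  B \in p -> @lpoint m x y w z @: B \in sp_tensor p q.
Proof. by move=> Bp; apply/setUP; left; apply: imset_f. Qed.

Lemma sp_tensor_r x y w z (p : spart m x y) (q : spart m w z)
    (B : {set spoint m w z}) :
  B \in q -> @rpoint m x y w z @: B \in sp_tensor p q.
Proof. by move=> Bq; apply/setUP; right; apply: imset_f. Qed.

Lemma sp_tensor_inv x y w z (p : spart m x y) (q : spart m w z)
    (B : {set spoint m (x ++ w) (y ++ z)}) u v :
  B \in sp_tensor p q -> u \in B -> v \in B ->
  (exists B' u' v', [/\ B' \in p, u' \in B', v' \in B',
     u = lpoint w z u' & v = lpoint w z v']) \/
  (exists B' u' v', [/\ B' \in q, u' \in B', v' \in B',
     u = rpoint x y u' & v = rpoint x y v']).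
Proof.
case/setUP => /imsetP [B' B'P ->] /imsetP [u' uB' ->] /imsetP [v' vB' ->].
- by left; exists B', u', v'.
- by right; exists B', u', v'.
Qed.

Lemma sp_inv_block x y (p : spart m x y) (B : {set spoint m x y}) :
  B \in p -> @flip_point m x y @: B \in sp_inv p.
Proof. exact: imset_f. Qed.

Lemma sp_id_inv x (B : {set spoint m x x}) u v :
  B \in sp_id m x -> u \in B -> v \in B ->
  exists k l, (u = (inl k, l) \/ u = (inr k, l)) /\
              (v = (inl k, l) \/ v = (inr k, l)).
Proof.
case/imsetP => [[k l] _ ->] uB vB; exists k, l.
by case/set2P: uB; case/set2P: vB; auto.
Qed.

Lemma sp_id_block x k l :
  [set (inl k, l); (inr k, l)] \in sp_id m x.
Proof. by apply/imsetP; exists (k, l). Qed.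

(** Turns a conjugate equation into a statement about paths: it says both that levels never mix and
    that the strand of each level really reaches the other side. *)
Lemma sp_comp_id1 c y (p : spart m y [:: c]) (q : spart m [:: c] y) u v :
  sp_comp p q = sp_id m [:: c] ->
  connect (same_block p q) (out_rows y u) (out_rows y v) <-> u.2 = v.2.
Proof.
move=> pq.
have /= -> := mem_equivalence_partition u v (connect_equivalence p q).
rewrite -/(sp_comp p q) pq; split.
- by case=> B [Bid uB vB]; have [k [l [[->|->] [->|->]]]] := sp_id_inv Bid uB vB.
- case: u v => [u l] [v k] /= <-; exists [set (inl ord0, l); (inr ord0, l)].
  split; first exact: sp_id_block.
  + by rewrite !inE; case: u => i; rewrite (ord1 i) eqxx ?orbT.
  + by rewrite !inE; case: v => i; rewrite (ord1 i) eqxx ?orbT.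
Qed.

End Composition.

Section Duality.
Variables (m : nat) (a b : colour).
Variables (r : spart m [::] [:: a; b]) (s : spart m [::] [:: b; a]).
Hypothesis rs : @sp_comp m [:: a] [:: a; b; a] [:: a]
  (sp_tensor (sp_inv r) (sp_id m [:: a])) (sp_tensor (sp_id m [:: a]) s)
  = sp_id m [:: a].

Local Notation p := (sp_tensor (sp_inv r) (sp_id m [:: a])).
Local Notation q := (sp_tensor (sp_id m [:: a]) s).
Local Notation point l k := ((inr (l : 'I_2), k) : spoint m [::] [:: _; _]).
Local Notation top k := ((inl (inl ord0), k) : row3 m [:: a] [:: a; b; a] [:: a]).
Local Notation mid i k :=
  ((inl (inr (i : 'I_3)), k) : row3 m [:: a] [:: a; b; a] [:: a]).
Local Notation bot k := ((inr ord0, k) : row3 m [:: a] [:: a; b; a] [:: a]).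
Local Notation linked :=
  (connect (@same_block m [:: a] [:: a; b; a] [:: a] p q)).
Local Notation o0 := (ord0 : 'I_3).
Local Notation o1 := (lift ord0 ord0 : 'I_3).
Local Notation o2 := (ord_max : 'I_3).

Lemma linked_sym : connect_sym (@same_block m [:: a] [:: a; b; a] [:: a] p q).
Proof. exact/sym_connect_sym/same_block_sym. Qed.

(** The edges of the zigzag: identity strands join [top] to [mid o0] and [mid o2] to [bot], a block
    of [r] joins points of the first two middle columns, a block of [s] points of the last two. *)
Lemma linked_top k : linked (top k) (mid o0 k).
Proof.
have := @same_block_top m [:: a] [:: a; b; a] [:: a] p q _ _ _
  (sp_tensor_l s (@sp_id_block m [:: a] (ord0 : 'I_1) k))
  (imset_f _ (set21 _ _)) (imset_f _ (set22 _ _)).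
rewrite /top_rows /lpoint /= => h; apply: connect1; congr same_block: h.
- by congr (inl (inl _), _); apply: val_inj.
- by congr (inl (inr _), _); apply: val_inj.
Qed.

Lemma linked_bot k : linked (mid o2 k) (bot k).
Proof.
have := @same_block_bot m [:: a] [:: a; b; a] [:: a] p q _ _ _
  (sp_tensor_r (sp_inv r) (@sp_id_block m [:: a] (ord0 : 'I_1) k))
  (imset_f _ (set21 _ _)) (imset_f _ (set22 _ _)).
rewrite /bot_rows /rpoint /= => h; apply: connect1; congr same_block: h.
- by congr (inl (inr _), _); apply: val_inj.
- by congr (inr _, _); apply: val_inj.
Qed.

Lemma linked_r (B : {set spoint m [::] [:: a; b]}) (i j : 'I_2) k l :
  B \in r -> point i k \in B -> point j l \in B ->
  linked (mid (widen_ord (isT : 2 <= 3) i) k) (mid (widen_ord (isT : 2 <= 3) j) l).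
Proof.
move=> Br ik jl.
have := @same_block_bot m [:: a] [:: a; b; a] [:: a] p q _ _ _
  (sp_tensor_l (sp_id m [:: a]) (sp_inv_block Br))
  (imset_f _ (imset_f _ ik)) (imset_f _ (imset_f _ jl)).
rewrite /bot_rows /lpoint /= => h; apply: connect1; congr same_block: h.
- by congr (inl (inr _), _); apply: val_inj.
- by congr (inl (inr _), _); apply: val_inj.
Qed.

Lemma linked_s (B : {set spoint m [::] [:: b; a]}) (i j : 'I_2) k l :
  B \in s -> point i k \in B -> point j l \in B ->
  linked (mid (lift ord0 i) k) (mid (lift ord0 j) l).
Proof.
move=> Bs ik jl.
have := @same_block_top m [:: a] [:: a; b; a] [:: a] p q _ _ _
  (sp_tensor_r (sp_id m [:: a]) Bs) (imset_f _ ik) (imset_f _ jl).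
rewrite /top_rows /rpoint /= => h; apply: connect1; congr same_block: h.
- by congr (inl (inr _), _); apply: val_inj.
- by congr (inl (inr _), _); apply: val_inj.
Qed.

Lemma linked_level k l :
  [/\ linked (top k) (top l) -> k = l, linked (top k) (bot l) -> k = l,
      linked (bot k) (bot l) -> k = l & linked (top k) (bot k)].
Proof.
have h u v := sp_comp_id1 u v rs.
split.
- exact: (h (inl ord0, k) (inl ord0, l)).1.
- exact: (h (inl ord0, k) (inr ord0, l)).1.
- exact: (h (inr ord0, k) (inr ord0, l)).1.
- exact: (h (inl ord0, k) (inr ord0, k)).2.
Qed.

(** The block would give a path from [top k] to [top l], and the identity separates the levels of
    its upper row. *)
Lemma duality_injl (B : {set spoint m [::] [:: a; b]}) k l :
  B \in r -> point ord0 k \in B -> point ord0 l \in B -> k = l.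
Proof.
move=> Br kB lB; have [+ _ _ _] := linked_level k l; apply.
apply: connect_trans (linked_top k) _; rewrite linked_sym.
apply: connect_trans (linked_top l) _; rewrite linked_sym.
by have := linked_r Br kB lB; congr connect; congr (inl (inr _), _); apply: val_inj.
Qed.

Lemma duality_injr (B : {set spoint m [::] [:: b; a]}) k l :
  B \in s -> point ord_max k \in B -> point ord_max l \in B -> k = l.
Proof.
move=> Bs kB lB; have [_ _ + _] := linked_level k l; apply.
apply: connect_trans _ (linked_bot l); rewrite linked_sym.
apply: connect_trans _ (linked_bot k); rewrite linked_sym.
by have := linked_s Bs kB lB; congr connect; congr (inl (inr _), _); apply: val_inj.
Qed.

(** The path runs through the whole zigzag and changes from [r] to [s] at [mid o1 k]. *)
Lemma duality_trans (B : {set spoint m [::] [:: a; b]})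
    (B' : {set spoint m [::] [:: b; a]}) j k l :
  B \in r -> B' \in s -> point ord0 j \in B -> point ord_max k \in B ->
  point ord0 k \in B' -> point ord_max l \in B' -> j = l.
Proof.
move=> Br B's jB kB kB' lB'; have [_ + _ _] := linked_level j l; apply.
apply: connect_trans (linked_top j) (connect_trans _ (linked_bot l)).
apply: (@connect_trans _ _ (mid o1 k)).
- by have := linked_r Br jB kB; congr connect; congr (inl (inr _), _); apply: val_inj.
- by have := linked_s B's kB' lB'; congr connect; congr (inl (inr _), _); apply: val_inj.
Qed.

(* Otherwise the points [top k] and [mid o0 k] would form a whole block of the
   composition before deletion, so [top k] would not be joined to [bot k]. *)
Lemma duality_meet (B : {set spoint m [::] [:: a; b]}) k :
  B \in r -> finset.partition r [set: spoint m [::] [:: a; b]] ->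
  point ord0 k \in B -> exists l, point ord_max l \in B.
Proof.
move=> Br rP kB; apply: contrapT => Bb.
have [_ _ _ kk] := linked_level k k.
(* The indicator of these two points, an invariant that tells [top k] from [bot k]. *)
pose f (u : row3 m [:: a] [:: a; b; a] [:: a]) :=
  match u.1 with
  | inl (inl _) => u.2 == k
  | inl (inr i) => (val i == 0) && (u.2 == k)
  | inr _ => false
  end.
suff : f (top k) = f (bot k) by rewrite /f /= eqxx.
apply: connect_const kk => D u v DP uD vD.
- case: (@sp_tensor_inv m [:: a] [:: a] [::] [:: b; a] _ _ D u v DP uD vD)
    => -[D' [u' [v' [D'P uD' vD' -> ->]]]].
  + have [i [l [uE vE]]] := sp_id_inv D'P uD' vD'.
    have fE w : w = (inl i, l) \/ w = (inr i, l) ->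
        f (top_rows [:: a] (lpoint [::] [:: b; a] w)) = (l == k).
      by case=> ->; rewrite /f //=; case: i {uE vE} => -[].
    by rewrite !fE.
  + by case: u' v' {uD' vD'} => [[[]//|i] l] [[[]//|j] l'].
- case: (@sp_tensor_inv m [:: a; b] [::] [:: a] [:: a] _ _ D u v DP uD vD)
    => -[D' [u' [v' [D'P uD' vD' -> ->]]]].
  + case/imsetP: D'P uD' vD' => D0 D0r ->.
    move=> /imsetP [u0 uD0 ->] /imsetP [v0 vD0 ->].
    (* By [Bb] and [duality_injl] the block [B] is the single first-leg point of level [k], so [f]
       is true on [B] and false on every other block of [r]. *)
    have fE w : w \in D0 ->
        f (bot_rows [:: a] (lpoint [:: a] [:: a] (flip_point w))) = (D0 == B).
      case: w => [[[]//|i] l] wD0; rewrite /f /=.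
      apply/andP/eqP => [[/eqP i0 /eqP lk]|D0B].
        apply: (partition_inj rP D0r Br wD0); rewrite lk.
        by congr (_ \in B): kB; congr (inr _, _); apply: val_inj.
      move: wD0; rewrite D0B; case: i => -[|[|//]] i2 wB; last first.
        case: Bb; exists l.
        by congr (_ \in B): wB; congr (inr _, _); apply: val_inj.
      split=> //; apply/eqP; apply: (duality_injl Br _ kB).
      by congr (_ \in B): wB; congr (inr _, _); apply: val_inj.
    by rewrite !fE.
  + have [i [l [uE vE]]] := sp_id_inv D'P uD' vD'.
    have fE w : w = (inl i, l) \/ w = (inr i, l) ->
        f (bot_rows [:: a] (rpoint [:: a; b] [::] w)) = false.
      by case=> ->.
    by rewrite !fE.
Qed.

End Duality.

(** The equation [rs] gives every first-leg point a partner and keeps first-leg levels apart; [sr]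
    keeps second-leg levels apart. So blocks are pairs, and since there are finitely many levels the
    injection [f] is onto and its pairs exhaust [r]. *)
Lemma duality_perm (m : nat) (a b : colour)
    (r : spart m [::] [:: a; b]) (s : spart m [::] [:: b; a]) :
  finset.partition r [set: spoint m [::] [:: a; b]] ->
  @sp_comp m [:: a] [:: a; b; a] [:: a]
    (sp_tensor (sp_inv r) (sp_id m [:: a])) (sp_tensor (sp_id m [:: a]) s)
    = sp_id m [:: a] ->
  @sp_comp m [:: b] [:: b; a; b] [:: b]
    (sp_tensor (sp_inv s) (sp_id m [:: b])) (sp_tensor (sp_id m [:: b]) r)
    = sp_id m [:: b] ->
  exists sigma : 'S_m, r = sp_perm sigma a b.
Proof.
move=> rP rs sr.
have [/eqP rT rI /negP r0] := and3P rP.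
pose pt (i : 'I_2) k : spoint m [::] [:: a; b] := (inr i, k).
have ptE (i : 'I_2) k : pt i k = pt ord0 k \/ pt i k = pt ord_max k.
  by case: i => -[|[|//]] i2; [left|right]; congr (inr _, _); apply: val_inj.
have cover_r u : exists2 B, B \in r & u \in B.
  by apply/bigcupP; rewrite -/(finset.cover r) rT inE.
have link k : exists l, exists B, [/\ B \in r, pt ord0 k \in B & pt ord_max l \in B].
  have [B Br kB] := cover_r (pt ord0 k).
  by have [l lB] := duality_meet rs Br rP kB; exists l, B.
have [f fP] := choice link.
have fI : injective f.
  move=> k l; have [B [Br kB fkB]] := fP k; have [D [Dr lD flD]] := fP l.
  move=> fkl; rewrite -fkl in flD; rewrite (partition_inj rP Dr Br flD fkB) in lD.
  exact: (duality_injl rs Br kB lD).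
have blockE B k : B \in r -> pt ord0 k \in B \/ pt ord_max (f k) \in B ->
    B = [set pt ord0 k; pt ord_max (f k)].
  move=> Br kB; have [D [Dr kD fkD]] := fP k.
  have DB : D = B by case: kB; exact: (partition_inj rP Dr).
  rewrite -{}DB in Br kB *; apply/setP => u; rewrite !inE.
  apply/idP/orP => [|[/eqP->|/eqP->] //].
  case: u => [[[]//|i] l]; have [|] := ptE i l; rewrite /pt => -> lD.
  - by left; rewrite (duality_injl rs Dr kD lD).
  - by right; rewrite (duality_injr sr Dr fkD lD).
exists (perm fI); apply/setP => B; apply/idP/imsetP => [Br|[k _ ->]].
- have [/set0Pn [u uB]] : B != finset.set0 by apply: contra_notN r0 => /eqP <-.
  have [k kB] : exists k, pt ord0 k \in B \/ pt ord_max (f k) \in B.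
    case: u uB => [[[]//|i] l]; have [|] := ptE i l; rewrite /pt => -> lB.
    + by exists l; left.
    + have [g _ gK] := injF_bij fI; exists (g l); right; by rewrite gK.
  by exists k => //; rewrite permE; exact: blockE.
- have [D [Dr kD fkD]] := fP k; congr (_ \in r): (Dr).
  by rewrite permE; apply: blockE => //; left.
Qed.

Lemma duality_perms (m : nat) (a b : colour)
    (r : spart m [::] [:: a; b]) (s : spart m [::] [:: b; a]) :
  finset.partition r [set: spoint m [::] [:: a; b]] ->
  finset.partition s [set: spoint m [::] [:: b; a]] ->
  @sp_comp m [:: a] [:: a; b; a] [:: a]
    (sp_tensor (sp_inv r) (sp_id m [:: a])) (sp_tensor (sp_id m [:: a]) s)
    = sp_id m [:: a] ->
  @sp_comp m [:: b] [:: b; a; b] [:: b]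
    (sp_tensor (sp_inv s) (sp_id m [:: b])) (sp_tensor (sp_id m [:: b]) r)
    = sp_id m [:: b] ->
  exists sigma : 'S_m, r = sp_perm sigma a b /\ s = sp_perm sigma^-1 b a.
Proof.
move=> rP sP rs sr.
have [sigma rE] := duality_perm rP rs sr; have [tau sE] := duality_perm sP sr rs.
exists sigma; split=> //; rewrite sE; congr sp_perm; apply/permP => k.
apply: (@perm_inj _ sigma); rewrite permKV.
rewrite {}rE {}sE in rs sr.
(* In [sr] the zigzag starts with [s]: level [k] goes to [tau k] and then through [r] to
   [sigma (tau k)], which must be [k] again. *)
symmetry; apply: (@duality_trans _ _ _ _ _ sr _ _ k (tau k)).
- by apply/imsetP; exists k.
- by apply/imsetP; exists (tau k).
- exact: set21.
- exact: set22.
- exact: set21.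
- exact: set22.
Qed.

(** * Permuting the levels of the points of one colour *)

Section Relabel.
Variables (m : nat) (pi : colour -> 'S_m).

Definition point_colour x y (u : 'I_(size x) + 'I_(size y)) : colour :=
  match u with inl i => letter x i | inr j => letter y j end.

Definition relabel x y (u : spoint m x y) : spoint m x y :=
  (u.1, pi (point_colour u.1) u.2).

Definition relabel_part x y (p : spart m x y) : spart m x y :=
  [set (@relabel x y) @: (B : {set spoint m x y}) | B in p].

Lemma relabel_inj x y : injective (@relabel x y).
Proof. by move=> [i k] [j l] [<- /perm_inj <-]. Qed.

Lemma relabel_part_inj x y : injective (@relabel_part x y).
Proof. exact/imset_inj/imset_inj/relabel_inj. Qed.

Lemma relabel_tensor x y w z (p : spart m x y) (q : spart m w z) :
  relabel_part (sp_tensor p q) = sp_tensor (relabel_part p) (relabel_part q).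
Proof.
rewrite /relabel_part /sp_tensor imsetU -!imset_comp; congr (_ :|: _).
- apply: eq_imset => B /=; rewrite -!imset_comp; apply: eq_imset => -[[i|i] k];
    by rewrite /relabel /lpoint /= letter_lpos.
- apply: eq_imset => B /=; rewrite -!imset_comp; apply: eq_imset => -[[i|i] k];
    by rewrite /relabel /rpoint /= letter_rpos.
Qed.

Lemma relabel_inv x y (p : spart m x y) :
  relabel_part (sp_inv p) = sp_inv (relabel_part p).
Proof.
rewrite /relabel_part /sp_inv -!imset_comp; apply: eq_imset => B /=.
by rewrite -!imset_comp; apply: eq_imset => -[[i|i] k].
Qed.

Lemma relabel_id x : relabel_part (sp_id m x) = sp_id m x.
Proof.
have E i k : (@relabel x x) @: [set (inl i, k); (inr i, k)] =
    [set (inl i, pi (letter x i) k); (inr i, pi (letter x i) k)].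
  by rewrite imsetU !imset_set1.
rewrite /relabel_part /sp_id -imset_comp; apply/setP => B.
apply/imsetP/imsetP => -[[i k] _ ->] /=.
- by exists (i, pi (letter x i) k) => //=; rewrite E.
- by exists (i, (pi (letter x i))^-1%g k) => //=; rewrite E permKV.
Qed.

(** A lower point of [q] and the upper point of [p] identified with it have the same colour, so they
    move to the same level. Hence the relabelling extends to a bijection [h] of the three rows that
    preserves links. *)
Lemma relabel_comp x y z (p : spart m y z) (q : spart m x y) :
  relabel_part (sp_comp p q) = sp_comp (relabel_part p) (relabel_part q).
Proof.
apply: imset_equivalence_partition; first exact: relabel_inj.
pose h (u : row3 m x y z) : row3 m x y z :=
  (u.1, pi (match u.1 with
            | inl (inl i) => letter x i
            | inl (inr j) => letter y j
            | inr k => letter z k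
            end) u.2).
have hI : injective h by move=> [i k] [j l] [<- /perm_inj <-].
have hout u : out_rows y (@relabel x z u) = h (out_rows y u) by case: u => [[]].
have htop u : top_rows z (@relabel x y u) = h (top_rows z u) by case: u => [[]].
have hbot u : bot_rows x (@relabel y z u) = h (bot_rows x u) by case: u => [[]].
have htopE (B : {set spoint m x y}) u :
    (h u \in @top_rows m x y z @: (@relabel x y @: B)) =
    (u \in @top_rows m x y z @: B).
  by rewrite -imset_comp (eq_imset _ htop) imset_comp mem_imset.
have hbotE (B : {set spoint m y z}) u :
    (h u \in @bot_rows m x y z @: (@relabel y z @: B)) =
    (u \in @bot_rows m x y z @: B).
  by rewrite -imset_comp (eq_imset _ hbot) imset_comp mem_imset.
move=> u v; rewrite !hout; apply: connect_bij; first exact: injF_bij.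
move=> {}u {}v; rewrite /same_block; congr (_ || _).
- apply/exists_inP/exists_inP => [[_ /imsetP [B Bq ->]]|[B Bq]].
    by rewrite !htopE; exists B.
  by exists (@relabel x y @: B); rewrite ?htopE ?imset_f.
- apply/exists_inP/exists_inP => [[_ /imsetP [B Bq ->]]|[B Bq]].
    by rewrite !hbotE; exists B.
  by exists (@relabel y z @: B); rewrite ?hbotE ?imset_f.
Qed.

(** With [pi] trivial on white and [sigma] on black, the identity pairings are sent to the two
    partitions found in [duality_perms]. *)
Lemma relabel_perm (a b : colour) :
  relabel_part (sp_perm 1 a b) = sp_perm ((pi a)^-1 * pi b)%g a b.
Proof.
have E k : (@relabel [::] [:: a; b]) @:
      [set (inr (ord0 : 'I_2), k); (inr (ord_max : 'I_2), k)] =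
    [set (inr (ord0 : 'I_2), pi a k); (inr (ord_max : 'I_2), pi b k)].
  by rewrite imsetU !imset_set1.
rewrite /relabel_part /sp_perm -imset_comp; apply/setP => B.
apply/imsetP/imsetP => -[k _ ->] /=.
- by exists (pi a k) => //=; rewrite perm1 E permM permK.
- by exists ((pi a)^-1%g k) => //=; rewrite perm1 E permM permKV.
Qed.

Lemma relabel_partition x y (p : spart m x y) :
  finset.partition (relabel_part p) [set: spoint m x y] =
  finset.partition p [set: spoint m x y].
Proof.
rewrite -(imset_partition p [set: spoint m x y] (@relabel_inj x y)).
congr (finset.partition _ _); apply/setP => u; rewrite inE.
have [g _ gK] := injF_bij (@relabel_inj x y).
by rewrite -(gK u) imset_f.
Qed.

(** A preimage, so that closure properties transfer by rewriting membership; with [sigma] on black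
    points, the elements of [C] are thereby moved by the inverse of [sigma]. *)
Definition relabel_family (C : spart_family m) : spart_family m :=
  fun x y => [set p | relabel_part p \in C x y].

Lemma relabel_category C : spatial_category C -> spatial_category (relabel_family C).
Proof.
case=> Cpart CW CB Ccomp Ctens Cinv; split.
- by move=> x y p; rewrite inE => /Cpart; rewrite relabel_partition.
- by rewrite inE relabel_id.
- by rewrite inE relabel_id.
- by move=> x y z p q; rewrite !inE relabel_comp; exact: Ccomp.
- by move=> x y w z p q; rewrite !inE relabel_tensor; exact: Ctens.
- by move=> x y p; rewrite !inE relabel_inv; exact: Cinv.
Qed.

(** Relabelling commutes with all operations, fixes identities and is injective, so it can be
    cancelled from the equation. The words are given explicitly because the middle ones agree only
    by computation. *)
Lemma relabel_conjugate (a b : colour)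
    (r : spart m [::] [:: a; b]) (s : spart m [::] [:: b; a]) :
  @sp_comp m [:: a] [:: a; b; a] [:: a]
    (sp_tensor (sp_inv (relabel_part r)) (sp_id m [:: a]))
    (sp_tensor (sp_id m [:: a]) (relabel_part s)) = sp_id m [:: a] ->
  @sp_comp m [:: a] [:: a; b; a] [:: a]
    (sp_tensor (sp_inv r) (sp_id m [:: a])) (sp_tensor (sp_id m [:: a]) s)
    = sp_id m [:: a].
Proof.
have := @relabel_tensor [:: a; b] [::] [:: a] [:: a] (sp_inv r) (sp_id m [:: a]).
have := @relabel_tensor [:: a] [:: a] [::] [:: b; a] (sp_id m [:: a]) s.
rewrite relabel_inv !relabel_id => sE rE rs.
apply: relabel_part_inj; rewrite relabel_id -[RHS]rs.
apply: etrans (@relabel_comp [:: a] [:: a; b; a] [:: a] _ _) _.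
exact: (f_equal2 (@sp_comp m [:: a] [:: a; b; a] [:: a]) rE sE).
Qed.

Lemma relabel_rigid C : rigid C -> rigid (relabel_family C).
Proof.
case=> r [s [rC sC rs sr]].
have [f _ fK] := injF_bij (@relabel_part_inj [::] [:: White; Black]).
have [g _ gK] := injF_bij (@relabel_part_inj [::] [:: Black; White]).
exists (f r), (g s); split; rewrite ?inE ?fK ?gK //.
- by apply: relabel_conjugate; rewrite fK gK.
- by apply: relabel_conjugate; rewrite fK gK.
Qed.

Lemma relabel_graded (n : 'I_m -> nat) C :
  (forall c k, n (pi c k) = n k) -> graded n C -> graded n (relabel_family C).
Proof.
move=> npi Cn x y p; rewrite inE => /Cn pn B u v Bp uB vB.
have := pn (@relabel x y @: B) (relabel u) (relabel v).
by rewrite !npi; apply; exact: imset_f.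
Qed.

End Relabel.

Lemma graded_sp_perm (m : nat) (n : 'I_m -> nat) (sigma : 'S_m) a b :
  graded_part n (sp_perm sigma a b) -> forall k, n (sigma k) = n k.
Proof.
move=> h k; apply: (h _ (inr (ord_max : 'I_2), sigma k) (inr (ord0 : 'I_2), k)).
- by apply/imsetP; exists k.
- exact: set22.
- exact: set21.
Qed.

(** * Operators and intertwiners *)

Import Order.TTheory GRing.Theory Num.Theory.

Local Open Scope ring_scope.
Local Open Scope complex_scope.

Section MatrixRing.
Variable S : pzRingType.

Lemma mat_eq (T : Type) (J I : finType) (v w : mat T J I) :
  (forall j i, v j i = w j i) -> v = w.
Proof. by move=> vw; apply/funext => j; apply/funext => i. Qed.

Lemma mmulA (L K J I : finType) (a : mat S L K) (b : mat S K J) (c : mat S J I) :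
  mmul a (mmul b c) = mmul (mmul a b) c.
Proof.
apply: mat_eq => l i; rewrite /mmul.
under eq_bigr do rewrite mulr_sumr; rewrite exchange_big /=.
by apply: eq_bigr => j _; rewrite mulr_suml; under eq_bigr do rewrite mulrA.
Qed.

Lemma sum_deltal (I : finType) (i : I) (f : I -> S) :
  \sum_j (i == j)%:R * f j = f i.
Proof.
rewrite (bigD1 i) //= eqxx mul1r big1 ?addr0 // => j /negPf ij.
by rewrite eq_sym ij mul0r.
Qed.

Lemma sum_deltar (I : finType) (i : I) (f : I -> S) :
  \sum_j f j * (j == i)%:R = f i.
Proof.
rewrite (bigD1 i) //= eqxx mulr1 big1 ?addr0 // => j /negPf ij.
by rewrite ij mulr0.
Qed.

Lemma mmul1m (J I : finType) (a : mat S J I) : mmul (mone J) a = a.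
Proof. by apply: mat_eq => j i; exact: sum_deltal. Qed.

Lemma mmulm1 (J I : finType) (a : mat S J I) : mmul a (mone I) = a.
Proof. by apply: mat_eq => j i; exact: sum_deltar. Qed.

Lemma is_inverse_conj (J I : finType) (a : mat S J I) (b : mat S I J)
    (v w : mat S I I) :
  mmul a b = mone J -> mmul b a = mone I -> is_inverse v w ->
  is_inverse (mmul a (mmul v b)) (mmul a (mmul w b)).
Proof.
move=> ab ba [vw wv]; split.
- by rewrite -!mmulA (mmulA b) ba mmul1m (mmulA v) vw mmul1m ab.
- by rewrite -!mmulA (mmulA b) ba mmul1m (mmulA w) wv mmul1m ab.
Qed.

End MatrixRing.

Section Operators.
Variable R : realType.
Local Notation C := R[i].

Lemma adjK (J I : finType) (T : mat C J I) : adj (adj T) = T.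
Proof. by apply: mat_eq => j i; rewrite /adj conjcK. Qed.

Lemma mconj_one (I : finType) : mconj (mone I : mat C I I) = mone I.
Proof. by apply: mat_eq => j i; rewrite /mconj /mone rmorph_nat. Qed.

Lemma adj_one (I : finType) : adj (mone I : mat C I I) = mone I.
Proof. by apply: mat_eq => j i; rewrite /adj /mone rmorph_nat eq_sym. Qed.

Lemma adj_mul (K J I : finType) (a : mat C K J) (b : mat C J I) :
  adj (mmul a b) = mmul (adj b) (adj a).
Proof.
apply: mat_eq => i k; rewrite /adj /mmul rmorph_sum.
by apply: eq_bigr => j _; rewrite /= rmorphM mulrC.
Qed.

Lemma mconj_mul (K J I : finType) (a : mat C K J) (b : mat C J I) :
  mconj (mmul a b) = mmul (mconj a) (mconj b).
Proof.
apply: mat_eq => i k; rewrite /mconj /mmul rmorph_sum.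
by apply: eq_bigr => j _; rewrite /= rmorphM.
Qed.

Lemma unitary_adj (J I : finType) (Q : mat C J I) :
  unitary_op Q -> unitary_op (adj Q).
Proof. by case=> ? ?; split; rewrite adjK. Qed.

Lemma unitary_mul (K J I : finType) (P : mat C K J) (Q : mat C J I) :
  unitary_op P -> unitary_op Q -> unitary_op (mmul P Q).
Proof.
move=> [PP' P'P] [QQ' Q'Q]; split; rewrite adj_mul.
- by rewrite -mmulA (mmulA Q) QQ' mmul1m.
- by rewrite -mmulA (mmulA _ P) P'P mmul1m.
Qed.

Lemma unitary_col (J I : finType) (Q : mat C J I) c :
  unitary_op Q -> unitary_op (col_op Q c).
Proof.
case: c => // -[QQ' Q'Q]; split=> /=.
- by have /= := congr1 (@mconj R _ _) QQ'; rewrite mconj_mul mconj_one.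
- by have /= := congr1 (@mconj R _ _) Q'Q; rewrite mconj_mul mconj_one.
Qed.

Lemma adj_col (J I : finType) (Q : mat C J I) c :
  adj (col_op Q c) = col_op (adj Q) c.
Proof. by case: c. Qed.

(* [tens_op D x] is D^{x_1} \otimes ... \otimes D^{x_n}; unlike in [op_pow],
   the operators D^White and D^Black are unrelated. *)
Definition tens_op (J I : finType) (D : colour -> mat C J I) (x : word) :
    mat C (idx J x) (idx I x) :=
  fun s t => \prod_(k < size x) D (letter x k) (s k) (t k).
Arguments tens_op {J I} D x _ _.

Lemma tens_op_mul (K J I : finType) (D : colour -> mat C K J)
    (E : colour -> mat C J I) x :
  mmul (tens_op D x) (tens_op E x) = tens_op (fun c => mmul (D c) (E c)) x.
Proof.
apply: mat_eq => s t; rewrite /mmul /tens_op bigA_distr_bigA.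
by apply: eq_bigr => f _; rewrite big_split.
Qed.

Lemma tens_op_one (I : finType) x :
  tens_op (fun=> mone I : mat C I I) x = mone (idx I x).
Proof.
apply: mat_eq => s t; rewrite /tens_op /mone.
have [->|/eqP st] := eqVneq s t; first by rewrite big1 // => k _; rewrite eqxx.
have [k sk] : exists k, s k != t k.
  apply/existsP; apply: contra_notT st; rewrite negb_exists => /forallP st.
  by apply/ffunP => k; apply/eqP/negbNE/st.
by rewrite (bigD1 k) //= (negPf sk) mul0r.
Qed.

Lemma adj_tens_op (J I : finType) (D : colour -> mat C J I) x :
  adj (tens_op D x) = tens_op (fun c => adj (D c)) x.
Proof. by apply: mat_eq => s t; rewrite /adj /tens_op rmorph_prod. Qed.

Lemma unitary_tens_op (J I : finType) (D : colour -> mat C J I) x :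
  (forall c, unitary_op (D c)) -> unitary_op (tens_op D x).
Proof.
move=> uD; split; rewrite adj_tens_op tens_op_mul.
- by rewrite -(tens_op_one J x); congr (tens_op _ x); apply/funext => c; case: (uD c).
- by rewrite -(tens_op_one I x); congr (tens_op _ x); apply/funext => c; case: (uD c).
Qed.

End Operators.
Arguments tens_op {R J I} D x _ _.

Section StarMatrices.
Variables (R : realType) (A : cstarAlgType R).
Local Notation C := R[i].

(** Viewing scalar matrices over [A] turns the intertwiner relation into a matrix identity, so that
    associativity of [mmul] does the work. *)
Definition emb (J I : finType) (T : mat C J I) : mat A J I :=
  fun j i => (T j i)%:A.

Lemma star0 : star (0 : A) = 0.
Proof. by apply: (addrI (star 0)); rewrite -starD !addr0. Qed.

(* In [starZ], the conjugation is the generic [Num.conj]. *)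
Lemma starZc (c : C) (a : A) : star (c *: a) = conjc c *: star a.
Proof. exact: starZ. Qed.

Lemma star_sum (I : finType) (f : I -> A) :
  star (\sum_i f i) = \sum_i star (f i).
Proof. exact: (big_morph _ (@starD _ _) star0). Qed.

Lemma emb_mul (K J I : finType) (a : mat C K J) (b : mat C J I) :
  emb (mmul a b) = mmul (emb a) (emb b).
Proof.
apply: mat_eq => i k; rewrite /emb /mmul scaler_suml.
by apply: eq_bigr => j _; rewrite mulr_algl scalerA.
Qed.

Lemma emb_one (I : finType) : emb (mone I) = mone I.
Proof. by apply: mat_eq => i j; rewrite /emb /mone scaler_nat. Qed.

Lemma intertwinersE (I J : finType) (v : mat A I I) (w : mat A J J)
    (T : mat C J I) :
  intertwiners v w T <-> mmul (emb T) v = mmul w (emb T).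
Proof.
have El j i : \sum_k T j k *: v k i = mmul (emb T) v j i.
  by apply: eq_bigr => k _; rewrite mulr_algl.
have Er j i : \sum_l T l i *: w j l = mmul w (emb T) j i.
  by apply: eq_bigr => k _; rewrite mulr_algr.
split=> [h|h j i]; last by rewrite El Er h.
by apply: mat_eq => j i; rewrite -El -Er.
Qed.

Lemma intertwiners_comp (I J K : finType) (v : mat A I I) (w : mat A J J)
    (z : mat A K K) (T : mat C J I) (S : mat C K J) :
  intertwiners v w T -> intertwiners w z S -> intertwiners v z (mmul S T).
Proof.
move=> /intertwinersE hT /intertwinersE hS; apply/intertwinersE.
by rewrite emb_mul -mmulA hT !mmulA hS.
Qed.

Definition rep_tens (I : finType) (v : colour -> mat A I I) (x : word) :
    mat A (idx I x) (idx I x) :=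
  fun s t => \prod_(k < size x) v (letter x k) (s k) (t k).
Arguments rep_tens {I} v x _ _.

Lemma rep_powE (I : finType) (u ub : mat A I I) x :
  @rep_pow R I A u ub x =
  rep_tens (fun c => match c with White => u | Black => ub end) x.
Proof. by []. Qed.

(** Entries of [v] and [w] need not commute, but scalars are central and the factors keep the order
    of the word, so distributing products over sums suffices. *)
Lemma intertwiners_tens (I J : finType) (v : colour -> mat A I I)
    (w : colour -> mat A J J) (D : colour -> mat C J I) x :
  (forall c, intertwiners (v c) (w c) (D c)) ->
  intertwiners (rep_tens v x) (rep_tens w x) (tens_op D x).
Proof.
move=> hD s t; rewrite /tens_op /rep_tens.
under eq_bigr do rewrite -scaler_prod.
under [RHS]eq_bigr do rewrite -scaler_prod.
transitivity (\prod_(k < size x)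
    \sum_a D (letter x k) (s k) a *: v (letter x k) a (t k)).
  by rewrite bigA_distr_bigA.
transitivity (\prod_(k < size x)
    \sum_b D (letter x k) b (t k) *: w (letter x k) (s k) b).
  by apply: eq_bigr => k _; exact: hD.
by rewrite bigA_distr_bigA.
Qed.

(* [v] written in the orthonormal basis given by the columns of [F]. *)
Definition conj_mx (I J : finType) (F : mat C I J) (v : mat A I I) : mat A J J :=
  mmul (emb (adj F)) (mmul v (emb F)).

Lemma conj_mx_one (I : finType) (v : mat A I I) : conj_mx (mone I) v = v.
Proof. by rewrite /conj_mx adj_one emb_one mmul1m mmulm1. Qed.

Lemma ssa_zero (B : set A) : star_subalgebra B -> B 0.
Proof. by case=> B1 Blin _ _; rewrite -(subrr 1) addrC -scaleN1r; exact: Blin. Qed.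

Lemma ssa_sum (B : set A) (K : finType) (f : K -> A) :
  star_subalgebra B -> (forall k, B (f k)) -> B (\sum_k f k).
Proof.
move=> ssaB Bf; apply: big_ind => [|a b Ba Bb|k _]; first exact: ssa_zero.
- by rewrite -(scale1r a); exact: ssa_lin.
- exact: Bf.
Qed.

Lemma ssa_scale (B : set A) (c : C) a : star_subalgebra B -> B a -> B (c *: a).
Proof.
by move=> ssaB Ba; rewrite -(addr0 (_ *: _)); apply: ssa_lin => //; exact: ssa_zero.
Qed.

Section Conj.
Variables (I J : finType) (F : mat C I J).
Hypothesis uF : unitary_op F.

Let embFF' : mmul (emb F) (emb (adj F)) = mone I.
Proof. by rewrite -emb_mul uF.1 emb_one. Qed.

Let embF'F : mmul (emb (adj F)) (emb F) = mone J.
Proof. by rewrite -emb_mul uF.2 emb_one. Qed.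

Lemma conj_mxK v : conj_mx (adj F) (conj_mx F v) = v.
Proof.
by rewrite /conj_mx adjK -!mmulA embFF' mmulm1 mmulA embFF' mmul1m.
Qed.

Lemma intertwiners_conj v : intertwiners (conj_mx F v) v F.
Proof. by apply/intertwinersE; rewrite /conj_mx mmulA embFF' mmul1m. Qed.

Lemma intertwiners_conj_adj v : intertwiners v (conj_mx F v) (adj F).
Proof. by apply/intertwinersE; rewrite /conj_mx -!mmulA embFF' mmulm1. Qed.

Lemma star_mx_conj v : star_mx (conj_mx F v) = conj_mx F (star_mx v).
Proof.
apply: mat_eq => i j; rewrite /conj_mx /star_mx /mmul /emb /adj star_sum.
under eq_bigr do rewrite mulr_algl starZc conjcK star_sum scaler_sumr.
under [RHS]eq_bigr do rewrite mulr_algl scaler_sumr.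
rewrite exchange_big; apply: eq_bigr => a _; apply: eq_bigr => b _ /=.
by rewrite !mulr_algr starZc !scalerA mulrC.
Qed.

(** Entrywise [star] conjugates the scalars without transposing, so the basis change becomes its
    complex conjugate. *)
Lemma bar_mx_conj v : bar_mx (conj_mx F v) = conj_mx (mconj F) (bar_mx v).
Proof.
apply: mat_eq => i j; rewrite /conj_mx /bar_mx /mmul /emb /adj star_sum.
apply: eq_bigr => a _; rewrite !mulr_algl starZc star_sum; congr (_ *: _).
by apply: eq_bigr => b _; rewrite !mulr_algr starZc.
Qed.

Lemma is_inverse_conj_mx v w :
  is_inverse v w -> is_inverse (conj_mx F v) (conj_mx F w).
Proof. exact: is_inverse_conj. Qed.

Lemma unitary_conj_mx v : unitary_mx v -> unitary_mx (conj_mx F v).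
Proof. by rewrite /unitary_mx star_mx_conj; apply: is_inverse_conj_mx. Qed.

Lemma ssa_conj (B : set A) v :
  star_subalgebra B -> (forall i j, B (v i j)) ->
  forall i j, B (conj_mx F v i j).
Proof.
move=> ssaB Bv i j; apply: ssa_sum => // a; rewrite mulr_algl.
apply: ssa_scale => //; apply: ssa_sum => // b.
by rewrite mulr_algr; exact: ssa_scale.
Qed.

End Conj.

(** By [conj_mxK] the entries of [v] are linear combinations of those of [conj_mx F v]; this keeps
    the generated algebra dense after a change of basis. *)
Lemma generated_conj_mx (I J : finType) (F : mat C I J) (v : mat A I I) :
  unitary_op F ->
  (generated_star_algebra (entries v) `<=`
   generated_star_algebra (entries (conj_mx F v)))%classic.
Proof.
move=> uF a va B [ssaB wB]; apply: va; split=> // _ [i [j ->]].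
rewrite -(conj_mxK uF v); apply: ssa_conj => // k l.
by apply: wB; exists k, l.
Qed.

End StarMatrices.
Arguments rep_tens {R A I} v x _ _.

(** * Change of basis in a quantum group *)

Section Corepresentations.
Variables (R : realType) (A D : cstarAlgType R).
Local Notation C := R[i].

Lemma map_conj_mx (f : {lrmorphism A -> D}) (I J : finType) (F : mat C I J)
    (v : mat A I I) i j :
  f (conj_mx F v i j) = conj_mx F (fun k l => f (v k l)) i j.
Proof.
rewrite /conj_mx /mmul rmorph_sum; apply: eq_bigr => k _.
rewrite /= !mulr_algl linearZ rmorph_sum; congr (_ *: _).
by apply: eq_bigr => l _; rewrite /= !mulr_algr linearZ.
Qed.

Lemma conj_mx_mul (I J : finType) (F : mat C I J) (v w : mat D I I) :
  unitary_op F -> conj_mx F (mmul v w) = mmul (conj_mx F v) (conj_mx F w).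
Proof.
move=> [FF _]; rewrite /conj_mx -!mmulA; congr mmul; congr mmul.
by rewrite (mmulA (emb _ F)) -emb_mul FF emb_one mmul1m.
Qed.

(** Here [h], [f], [g] stand for the comultiplication and the two embeddings. All three fix scalars,
    and [F] times its adjoint cancels between the two factors. *)
Lemma corep_conj_mx (f g h : {lrmorphism A -> D}) (I J : finType)
    (F : mat C I J) (v : mat A I I) :
  unitary_op F ->
  (forall i j, h (v i j) = \sum_k f (v i k) * g (v k j)) ->
  forall i j, h (conj_mx F v i j) =
    \sum_k f (conj_mx F v i k) * g (conj_mx F v k j).
Proof.
move=> uF hv i j; rewrite map_conj_mx.
have -> : (fun k l => h (v k l)) =
    mmul (fun k l => f (v k l)) (fun k l => g (v k l)) by exact: mat_eq.
by rewrite conj_mx_mul //; apply: eq_bigr => k _; rewrite !map_conj_mx.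
Qed.

(** Each colour has its own unitary, so black legs can be changed independently of white ones. *)
Lemma intertwiners_conj_tens (I J : finType) (F : colour -> mat C I J)
    (v : colour -> mat A I I) x y :
  (forall c, unitary_op (F c)) ->
  intertwiners (rep_tens (fun c => conj_mx (F c) (v c)) x)
               (rep_tens (fun c => conj_mx (F c) (v c)) y) =
  [set mmul (tens_op (fun c => adj (F c)) y) (mmul X (tens_op F x)) |
     X in intertwiners (rep_tens v x) (rep_tens v y)]%classic.
Proof.
move=> uF.
have to_v z := @intertwiners_tens _ _ _ _ _ _ _ z
  (fun c => intertwiners_conj (uF c) (v c)).
have of_v z := @intertwiners_tens _ _ _ _ _ _ _ z
  (fun c => intertwiners_conj_adj (uF c) (v c)).
apply/seteqP; split=> [Y HY|_ [X HX <-]].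
- exists (mmul (tens_op F y) (mmul Y (tens_op (fun c => adj (F c)) x))).
    exact: intertwiners_comp (intertwiners_comp (of_v x) HY) (to_v y).
  rewrite -!adj_tens_op.
  have [[_ Fx] [_ Fy]] := (unitary_tens_op x uF, unitary_tens_op y uF).
  by rewrite -!mmulA Fx mmulm1 mmulA Fy mmul1m.
- exact: intertwiners_comp (intertwiners_comp (to_v x) HX) (of_v y).
Qed.

End Corepresentations.

Section ConjugateQuantumGroup.
Variables (R : realType) (I J : finType) (G : cmqg R I) (F : mat R[i] I J).
Hypothesis uF : unitary_op F.

Lemma norm_dense_sub (A : cstarAlgType R) (B B' : set A) :
  (B `<=` B')%classic -> norm_dense B -> norm_dense B'.
Proof. by move=> sub dB a e /(dB a) [b /sub Bb ab]; exists b. Qed.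

Lemma bar_mx_conj_invertible :
  exists w, is_inverse (bar_mx (conj_mx F (qg_u G))) w.
Proof.
have [w uw] := qg_bar_inv G; exists (conj_mx (mconj F) w).
by rewrite bar_mx_conj; apply: is_inverse_conj_mx uw; exact: (unitary_col Black uF).
Qed.

Definition conj_cmqg : cmqg R J :=
  CMQG (qg_tensP G) (@qg_Delta_star _ _ G) (unitary_conj_mx uF (qg_unitary G))
    bar_mx_conj_invertible
    (norm_dense_sub (generated_conj_mx uF) (@qg_gen _ _ G))
    (corep_conj_mx uF (@qg_DeltaE _ _ G)).

Lemma unitary_rep_conj_mx (K : finType) (L : mat R[i] I K)
    (v : mat (qg_alg G) I I) :
  unitary_op L -> unitary_rep v -> unitary_rep (conj_mx L v).
Proof.
move=> uL [uv Dv]; split; first exact: unitary_conj_mx.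
exact: corep_conj_mx.
Qed.

End ConjugateQuantumGroup.

(** * Spans of families of operators *)

Section Span.
Variable R : realType.
Local Notation C := R[i].

Lemma span_of_sandwich (F J I K L : finType) (P : {set F}) (T : F -> mat C J I)
    (a : mat C K J) (b : mat C I L) :
  [set mmul a (mmul X b) | X in span_of P T]%classic =
  span_of P (fun p => mmul a (mmul (T p) b)).
Proof.
have E (c : F -> C) : mmul a (mmul (fun j i => \sum_(p in P) c p * T p j i) b) =
    fun k l => \sum_(p in P) c p * mmul a (mmul (T p) b) k l.
  apply: mat_eq => k l; rewrite /mmul.
  under [RHS]eq_bigr do rewrite mulr_sumr.
  rewrite exchange_big /=; apply: eq_bigr => j _.
  under [RHS]eq_bigr do rewrite mulrCA mulr_sumr.
  rewrite -mulr_sumr exchange_big /=; congr (_ * _); apply: eq_bigr => i _.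
  by rewrite mulr_suml; apply: eq_bigr => p _; rewrite mulrA.
apply/seteqP; split=> [_ [_ [c ->] <-]|_ [c ->]].
- by exists c.
- by eexists; [exists c|].
Qed.

Lemma span_of_reindex (F J I : finType) (h : F -> F) (P : {set F})
    (T : F -> mat C J I) :
  injective h -> span_of [set p | h p \in P] (fun p => T (h p)) = span_of P T.
Proof.
move=> hI; have [g hK gK] := injF_bij hI.
have E (c : F -> C) j i : \sum_(p in P) c p * T p j i =
    \sum_(p in [set p | h p \in P]) c (h p) * T (h p) j i.
  rewrite (reindex h); last exact/onW_bij/injF_bij.
  by apply: eq_bigl => p; rewrite inE.
apply/seteqP; split=> _ [c ->].
- exists (c \o g); apply: mat_eq => j i; rewrite E.
  by apply: eq_bigr => p _; rewrite /= hK.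
- by exists (c \o h); apply: mat_eq => j i; rewrite E.
Qed.

Lemma span_of_mem (F J I : finType) (P : {set F}) (T : F -> mat C J I) p :
  p \in P -> span_of P T (T p).
Proof.
move=> pP; exists (fun q => (p == q)%:R); apply: mat_eq => j i.
rewrite (bigD1 p) //= eqxx mul1r big1 ?addr0 // => q /andP [_ /negPf qp].
by rewrite eq_sym qp mul0r.
Qed.

End Span.

(** * Level permutations as operators on tensor factors *)

Section LevelPermutations.
Variables (R : realType) (m : nat) (n : 'I_m -> nat) (pi : colour -> 'S_m).
Hypothesis npi : forall c k, n (pi c k) = n k.
Local Notation C := R[i].

Definition perm_multi c (t : multi n) : multi n :=
  [ffun k => cast_ord (npi c k) (t (pi c k))].

Lemma perm_multi_inj c : injective (perm_multi c).
Proof.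
move=> s t st; apply/ffunP => k; rewrite -(permKV (pi c) k).
have := congr1 (fun u : multi n => u ((pi c)^-1%g k)) st.
by rewrite !ffunE => /cast_ord_inj.
Qed.

Definition perm_op c : mat C (multi n) (multi n) :=
  fun s t => (t == perm_multi c s)%:R.

Lemma perm_op_one c : pi c = 1%g -> perm_op c = mone (multi n).
Proof.
move=> pic; apply: mat_eq => s t; rewrite /perm_op /mone eq_sym; congr (_ == _)%:R.
apply/ffunP => k; rewrite ffunE; apply: val_inj => /=.
by rewrite pic perm1.
Qed.

Lemma unitary_perm_op c : unitary_op (perm_op c).
Proof.
have [g gK Kg] := injF_bij (@perm_multi_inj c).
split; apply: mat_eq => s t; rewrite /mmul /adj /perm_op /mone.
- under eq_bigr do rewrite rmorph_nat eq_sym.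
  by rewrite sum_deltal (inj_eq (@perm_multi_inj c)).
- under eq_bigr do rewrite rmorph_nat -{1}(Kg s) (inj_eq (@perm_multi_inj c)).
  by rewrite sum_deltal Kg eq_sym.
Qed.

Definition perm_idx x (s : idx (multi n) x) : idx (multi n) x :=
  [ffun k => perm_multi (letter x k) (s k)].

Lemma tens_perm_op x (s t : idx (multi n) x) :
  tens_op perm_op x s t = (perm_idx s == t)%:R.
Proof.
rewrite /tens_op /perm_op; have [<-|st] := eqVneq (perm_idx s) t.
  by rewrite big1 // => k _; rewrite ffunE eqxx.
have [k sk] : exists k, t k != perm_multi (letter x k) (s k).
  apply/existsP; apply: contraNT st; rewrite negb_exists => /forallP st.
  by apply/eqP/ffunP => k; rewrite ffunE; have /negbNE/eqP := st k.
by rewrite (bigD1 k) //= (negPf sk) mul0r.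
Qed.

(** By [labelE], moving a point to another level and permuting the entries of the multi-indices have
    the same effect on labels. *)
Lemma Tpart_relabel x y (p : spart m x y) :
  Tpart R n (relabel_part pi p) =
  mmul (tens_op perm_op y)
    (mmul (Tpart R n p) (tens_op (fun c => adj (perm_op c)) x)).
Proof.
apply: mat_eq => s t; rewrite -adj_tens_op.
rewrite /mmul /adj; under eq_bigr do rewrite tens_perm_op.
rewrite sum_deltal; under eq_bigr do rewrite tens_perm_op rmorph_nat eq_sym.
rewrite sum_deltar /Tpart; congr (_ : bool)%:R.
have labelE u : label s t (relabel pi u) = label (perm_idx s) (perm_idx t) u.
  by case: u => [[k|k] l]; rewrite /label /= !ffunE.
apply/forallP/forallP => [h B|h D].
- apply/forallP => u; apply/forallP => v; apply/implyP => /and3P [Bp uB vB].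
  have /forallP /(_ (relabel pi u)) /forallP /(_ (relabel pi v)) :=
    h (@relabel m pi x y @: B).
  by rewrite !imset_f //= !labelE.
- apply/forallP => u; apply/forallP => v; apply/implyP => /and3P [].
  move=> /imsetP [B Bp ->] /imsetP [u' uB ->] /imsetP [v' vB ->].
  have /forallP /(_ u') /forallP /(_ v') := h B.
  by rewrite Bp uB vB /= !labelE.
Qed.

End LevelPermutations.

(** * Cup vectors and conjugate representations *)

Section Cups.
Variable R : realType.
Local Notation C := R[i].

(** The sum of the vectors [e_i] tensor [e_i], the standard solution of the conjugate equations; the
    colours enter only through the index type. *)
Definition cup (I : finType) (a b : colour) : mat C (idx I [:: a; b]) (idx I [::]) :=
  fun s _ => (s (ord0 : 'I_2) == s (ord_max : 'I_2))%:R.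
Arguments cup : clear implicits.

Lemma Tpart_sp_perm1 (m : nat) (n : 'I_m -> nat) a b :
  Tpart R n (sp_perm 1 a b) = cup (multi n) a b.
Proof.
apply: mat_eq => s t; congr (_ : bool)%:R.
apply/forallP/eqP => [h|h B].
- apply/ffunP => k; apply: val_inj.
  have /forallP /(_ (inr (ord0 : 'I_2), k)) /forallP
    /(_ (inr (ord_max : 'I_2), k)) /implyP :=
    h [set (inr (ord0 : 'I_2), k); (inr (ord_max : 'I_2), k)].
  rewrite set21 set22 !andbT => /(_ _)/eqP; apply.
  by apply/imsetP; exists k => //; rewrite perm1.
- apply/forallP => u; apply/forallP => v; apply/implyP => /and3P [].
  move=> /imsetP [k _ ->]; rewrite perm1 => /set2P uE /set2P vE.
  have E : label s t (inr (ord0 : 'I_2), k) = label s t (inr (ord_max : 'I_2), k).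
    exact: (congr1 (fun w : multi n => val (w k)) h).
  by case: uE => ->; case: vE => ->; rewrite ?E.
Qed.

Lemma idx1_eq (I : finType) c (s t : idx I [:: c]) :
  (s == t) = (s (ord0 : 'I_1) == t (ord0 : 'I_1)).
Proof.
apply/eqP/eqP => [->//|st]; apply/ffunP => k.
by have -> : k = (ord0 : 'I_1) by apply: val_inj; case: k => -[].
Qed.

Lemma cup_conjugate (I : finType) a b :
  @mmul C (idx I [:: a]) (idx I [:: a; b; a]) (idx I [:: a])
    (op_tensor (adj (cup I a b)) (op_id R I [:: a]))
    (op_tensor (op_id R I [:: a]) (cup I b a)) = op_id R I [:: a].
Proof.
apply: mat_eq => s t; pose i0 := (ord0 : 'I_1).
pose o0 : 'I_3 := ord0; pose o1 : 'I_3 := lift ord0 ord0; pose o2 : 'I_3 := ord_max.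
transitivity (\sum_(f : idx I [:: a; b; a])
    [&& f o0 == f o1, s i0 == f o2, f o0 == t i0 & f o1 == f o2]%:R : C).
  apply: eq_bigr => f _.
  have fl i j : val i = val j -> @lpart I [:: a; b] [:: a] f i = f j.
    by move=> ij; rewrite ffunE; congr (f _); apply: val_inj.
  have fr i j : (2 + val i)%N = val j -> @rpart I [:: a; b] [:: a] f i = f j.
    by move=> ij; rewrite ffunE; congr (f _); apply: val_inj.
  have fl' i j : val i = val j -> @lpart I [:: a] [:: b; a] f i = f j.
    by move=> ij; rewrite ffunE; congr (f _); apply: val_inj.
  have fr' i j : (1 + val i)%N = val j -> @rpart I [:: a] [:: b; a] f i = f j.
    by move=> ij; rewrite ffunE; congr (f _); apply: val_inj.
  have -> : op_tensor (adj (cup I a b)) (op_id R I [:: a]) s f =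
      ((f o0 == f o1) && (s i0 == f o2))%:R.
    rewrite /op_tensor /adj /cup /op_id /mone rmorph_nat -natrM mulnb idx1_eq.
    rewrite (fl _ o0) // (fl _ o1) // (fr _ o2) // ffunE.
    by congr (_ && (s _ == _))%:R; apply: val_inj.
  have -> : op_tensor (op_id R I [:: a]) (cup I b a) f t =
      ((f o0 == t i0) && (f o1 == f o2))%:R.
    rewrite /op_tensor /cup /op_id /mone -natrM mulnb idx1_eq.
    rewrite (fl' _ o0) // (fr' _ o1) // (fr' _ o2) // ffunE.
    by congr ((_ == t _) && _)%:R; apply: val_inj.
  by rewrite -natrM mulnb -andbA.
(* The Kronecker deltas force the middle triple [f] to be constant with value [t i0]; what remains
   is the condition that [s] and [t] agree. *)
rewrite (bigD1 [ffun=> t i0]) //= big1 ?addr0 => [|f].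
  by rewrite !ffunE !eqxx /= /op_id /mone idx1_eq andbT.
apply: contraNeq; rewrite pnatr_eq0 eqb0 negbK => /and4P [/eqP f01 _ /eqP f0 /eqP f12].
apply/eqP/ffunP => -[[|[|[|//]]] k3]; rewrite ffunE -f0.
- by congr (f _); apply: val_inj.
- by rewrite f01; congr (f _); apply: val_inj.
- by rewrite f01 f12; congr (f _); apply: val_inj.
Qed.

(** As [a] and [b] differ, one leg carries [Q] and the other its conjugate, so the sum over the
    diagonal is an entry of [Q] times its adjoint. Equal colours would give [Q] times its transpose
    instead. *)
Lemma sandwich_cup (I J : finType) (Q : mat C I J) a b :
  a <> b -> unitary_op Q ->
  mmul (op_pow Q [:: a; b]) (mmul (cup J a b) (op_pow (adj Q) [::])) = cup I a b.
Proof.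
move=> ab [QQ _]; apply: mat_eq => s t; pose i0 : 'I_2 := ord0; pose i1 : 'I_2 := ord_max.
have cupE (f : idx J [:: a; b]) :
    mmul (cup J a b) (op_pow (adj Q) [::]) f t = (f i0 == f i1)%:R.
  (* The empty word has a single index, at which the tensor power is the empty product 1. *)
  have g0 : idx J [::] by apply: finfun => -[].
  rewrite /mmul (bigD1 g0) //= big1 ?addr0 => [|g].
    by rewrite /op_pow big_ord0 mulr1.
  by have -> : g = g0 by [apply/ffunP => -[]]; rewrite eqxx.
transitivity (\sum_(f : idx J [:: a; b])
    if f i0 == f i1 then op_pow Q [:: a; b] s f else 0).
  apply: eq_bigr => f _; apply: etrans (congr1 _ (cupE f)) _.
  by rewrite mulr_natr mulrb.
(* Index words with equal letters are the constant ones, so the sum runs over [J]. *)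
rewrite -big_mkcond /= (reindex_onto
  (fun j => [ffun=> j] : idx J [:: a; b]) (fun f => f i0)).
  transitivity (\sum_j col_op Q a (s i0) j * col_op Q b (s i1) j).
    apply: eq_big => [j|j _]; first by rewrite !ffunE !eqxx.
    rewrite /op_pow !big_ord_recl big_ord0 mulr1 !ffunE.
    by have -> : lift ord0 ord0 = i1 by exact: val_inj.
  have QQE i j := congr1 (fun T : mat C I I => T i j) QQ.
  rewrite /cup -/i0 -/i1; case: a b ab {s t cupE} (s i0) (s i1) => -[] // _ i j /=.
  by rewrite eq_sym -[RHS]QQE; apply: eq_bigr => k _; rewrite mulrC.
move=> f /eqP f01; apply/ffunP => -[[|[|//]] k2]; rewrite ffunE ?f01.
- by rewrite -f01; congr (f _); apply: val_inj.
- by congr (f _); apply: val_inj.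
Qed.

Lemma is_conjugate_cup (I : finType) (G : cmqg R I) (ub : mat (qg_alg G) I I) :
  @qg_Hom R I G ub [::] [:: White; Black] (cup I White Black) ->
  @qg_Hom R I G ub [::] [:: Black; White] (cup I Black White) ->
  is_conjugate ub.
Proof.
move=> hr hs; exists (cup I White Black), (cup I Black White); split=> //.
- exact: cup_conjugate.
- exact: cup_conjugate.
Qed.

End Cups.
Arguments cup R I a b _ _ : clear implicits.

Theorem theorem1 (R : realType) (I : finType) (G : cmqg R I)
    (hG : is_spatial_partition_qg G) :
  exists (m : nat) (n : 'I_m -> nat) (C : spart_family m),
  [/\ (0 < m)%N,
      [/\ spatial_category C, graded n C & rigid C],
      sp_perm (1%g : 'S_m) White Black \in C [::] [:: White; Black],
      sp_perm (1%g : 'S_m) Black White \in C [::] [:: Black; White] &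
      (exists H : cmqg R (multi n), is_partition_qg C H) /\
      (forall H : cmqg R (multi n), is_partition_qg C H -> equivalent G H)].
Proof.
case: hG => ub [m [n [C [Q [uub m0 [Ccat Cgr Crig] uQ HomG]]]]].
have [r [s [rC sC rs sr]]] := Crig.
have [sigma [rE sE]] :=
  duality_perms (cat_partition Ccat rC) (cat_partition Ccat sC) rs sr.
pose pi c : 'S_m := if c is Black then sigma else 1%g.
have npi c k : n (pi c k) = n k.
  case: c => /=; first by rewrite perm1.
  by apply: (@graded_sp_perm m n sigma White Black); rewrite -rE; exact: Cgr rC.
pose C' := relabel_family pi C.
have C'WB : sp_perm 1 White Black \in C' [::] [:: White; Black].
  by rewrite inE relabel_perm /= invg1 mul1g -rE.
have C'BW : sp_perm 1 Black White \in C' [::] [:: Black; White].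
  by rewrite inE relabel_perm /= mulg1 -sE.
exists m, n, C'; split=> //.
  by split; [exact: relabel_category|exact: relabel_graded|exact: relabel_rigid].
(* The basis change seen by the relabelled category: [Q] on white legs, the conjugate of [Q] times
   the level permutation on black legs. *)
pose F c := mmul (col_op Q c) (perm_op R npi c).
have uQc c := unitary_col c uQ.
have uF c : unitary_op (F c) by apply: unitary_mul => //; exact: unitary_perm_op.
have FE z : tens_op F z = mmul (op_pow Q z) (tens_op (perm_op R npi) z).
  by rewrite -tens_op_mul.
have adjQ z : adj (op_pow Q z) = op_pow (adj Q) z.
  rewrite [LHS]adj_tens_op; congr (tens_op _ z).
  by apply/funext => c; exact: adj_col.
pose v c := if c is Black then ub else qg_u G.
have HomF x y : intertwiners (rep_tens v x) (rep_tens v y) =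
    span_of (C' x y) (fun p =>
      mmul (tens_op F y) (mmul (Tpart R n p) (adj (tens_op F x)))).
  transitivity (@qg_Hom R I G ub x y); first by [].
  rewrite HomG -(span_of_reindex _ _ (@relabel_part_inj m pi x y)).
  congr span_of; apply/funext => p.
  by rewrite (Tpart_relabel R npi) -adj_tens_op !FE adj_mul adjQ -!mmulA.
split.
  exists (conj_cmqg G (uF White)), (conj_mx (F Black) ub).
  split; first exact: (unitary_rep_conj_mx (uF Black) uub).
  move=> x y; rewrite /qg_Hom !rep_powE.
  rewrite (_ : (fun c => _) = fun c => conj_mx (F c) (v c)); last first.
    by apply/funext => -[].
  rewrite intertwiners_conj_tens // HomF span_of_sandwich.
  congr span_of; apply/funext => p; rewrite -adj_tens_op.
  have [[_ Fx] [_ Fy]] := (unitary_tens_op x uF, unitary_tens_op y uF).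
  by rewrite -!mmulA Fx mmulm1 mmulA Fy mmul1m.
move=> H [wb [uwb HomH]].
have HomHcup a b : sp_perm 1 a b \in C' [::] [:: a; b] ->
    @qg_Hom R _ H wb [::] [:: a; b] (cup R (multi n) a b).
  by move=> ab; rewrite HomH -Tpart_sp_perm1; exact: span_of_mem.
(* Chosen so that the adjoint of [L] times [F Black] is the conjugate of [Q]. Conjugating [ub] by
   [L] thus removes the permutation from the black legs, which is [LF] below. *)
pose L := mmul (F Black) (adj (col_op Q Black)).
have uL : unitary_op L by apply: unitary_mul => //; exact: unitary_adj.
pose ub' := conj_mx L ub.
have HomE x y : @qg_Hom R I G ub' x y =
    [set mmul (op_pow Q y) (mmul T (op_pow (adj Q) x)) |
       T in @qg_Hom R _ H wb x y]%classic.
  pose Lc c := if c is Black then L else mone I.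
  have uLc c : unitary_op (Lc c).
    by case: c => //; split; rewrite adj_one mmul1m.
  have LF z : mmul (adj (tens_op Lc z)) (tens_op F z) = op_pow Q z.
    rewrite adj_tens_op tens_op_mul; congr (tens_op _ z); apply/funext => -[] /=.
    - by rewrite adj_one mmul1m /F perm_op_one // mmulm1.
    - by rewrite /L adj_mul adjK -mmulA (uF Black).2 mmulm1.
  rewrite /qg_Hom !rep_powE.
  rewrite (_ : (fun c => _) = fun c => conj_mx (Lc c) (v c)); last first.
    by apply/funext => -[] //=; rewrite conj_mx_one.
  rewrite intertwiners_conj_tens // HomF -!rep_powE.
  rewrite -/(@qg_Hom R _ H wb x y) HomH !span_of_sandwich.
  congr span_of; apply/funext => p; rewrite -adj_tens_op.
  by rewrite -adjQ -!LF adj_mul adjK -!mmulA.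
exists ub', wb, (adj Q); split.
- split; first exact: unitary_rep_conj_mx.
  apply: is_conjugate_cup.
  (* The cups of [H], transported by [Q], are the cups on [I] by [sandwich_cup], so [ub'] is
     conjugate to the fundamental representation of [G]. *)
  + rewrite HomE -(sandwich_cup _ uQ) //; eexists; last by [].
    exact: HomHcup.
  + rewrite HomE -(sandwich_cup _ uQ) //; eexists; last by [].
    exact: HomHcup.
- by split=> //; apply: is_conjugate_cup; exact: HomHcup.
- exact: unitary_adj.
- by move=> x y; rewrite adjK; exact: HomE.
Qed.
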